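(* Let $(E,\overline\nabla)$ be a holomorphic bundle on $T_{\theta,\tau}$ and $(E^\vee,\overline\nabla^\vee)$ its dual left holomorphic bundle. For $i=0,1$ the pairing $$H^{1-i}(E)\otimes H^i(E^\vee)\to\mathbb C,\qquad [e]\otimes[f]\mapsto\operatorname{tr}(f(e)),$$ (equivalently, the pairing into $H^1(A_\theta)=A_\theta/\delta(A_\theta)\cong\mathbb C$ induced by $e\otimes f\mapsto f(e)$) is well defined and perfect.
   Context: Fix $\theta\in\mathbb R\setminus\mathbb Q$, $\tau\in\mathbb C\setminus\mathbb R$. $A_\theta$ is the algebra of series $\sum a_{m,n}U_1^mU_2^n$ with rapidly decreasing coefficients and $U_1U_2=e^{2\pi i\theta}U_2U_1$, $\delta(\sum a_{m,n}U_1^mU_2^n)=2\pi i\sum(m\tau+n)a_{m,n}U_1^mU_2^n$, and $\operatorname{tr}(\sum a_{m,n}U_1^mU_2^n)=a_{0,0}$ (this identifies $A_\theta/\delta(A_\theta)$ with $\mathbb C$). A (right) holomorphic bundle is a pair $(E,\overline\nabla)$ with $E$ a finitely generated projective right $A_\theta$-module and $\overline\nabla:E\to E$ $\mathbb C$-linear with $\overline\nabla(ea)=\overline\nabla(e)a+e\delta(a)$. Its dual is the finitely generated projective left $A_\theta$-module $E^\vee=\operatorname{Hom}_{A_\theta}(E,A_\theta)$ (with $(af)(e)=af(e)$) equipped with $\overline\nabla^\vee(f)=\delta\circ f-f\circ\overline\nabla$, which satisfies $\overline\nabla^\vee(af)=\delta(a)f+a\overline\nabla^\vee(f)$. For a right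 or left holomorphic bundle, $H^0=\ker\overline\nabla$ and $H^1=\operatorname{coker}\overline\nabla$. *)

(* Defs.v *)
From HB Require Import structures.
From mathcomp Require Import all_boot all_order all_algebra.
From mathcomp Require Import all_classical all_reals all_analysis.
From mathcomp Require Import complex.
Import Order.TTheory GRing.Theory Num.Theory.
Import numFieldNormedType.Exports.
Set Implicit Arguments. Unset Strict Implicit. Unset Printing Implicit Defensive.
Local Open Scope ring_scope.
Local Open Scope complex_scope.

Section NCTorus.
Variable R : realType.

(** Coefficient families (a_{m,n})_{m,n in Z}; an element sum a_{m,n} U1^m U2^n of A_theta
    is represented by its coefficient family, which must be rapidly decreasing. *)
Definition coeff := int -> int -> R[i].

Definition rapid (a : coeff) : Prop :=
  forall k : nat, exists M : R, forall m n : int,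
    `|a m n| * ((1 + `|m| + `|n|)%:~R) ^+ k <= M%:C.

Definition rapid_vec (n : nat) (v : 'I_n -> coeff) : Prop := forall k, rapid (v k).

Definition climn (u : nat -> R[i]) : R[i] :=
  (limn (fun N => complex.Re (u N))) +i* (limn (fun N => complex.Im (u N))).

(** sum over (p,q) in Z^2 as limit of the sums over the squares [-N,N]^2
    (this is the value of the series whenever it converges absolutely) *)
Definition zsum2 (F : int -> int -> R[i]) : R[i] :=
  climn (fun N : nat => \sum_(p < (N.*2).+1) \sum_(q < (N.*2).+1)
                          F (p%:Z - N%:Z) (q%:Z - N%:Z)).

Definition twist (theta : R) (k : int) : R[i] :=
  (cos (2 * pi * theta * k%:~R)) +i* (sin (2 * pi * theta * k%:~R)).

Definition zeroA : coeff := fun _ _ => 0.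
Definition oneA : coeff := fun m n => if (m == 0) && (n == 0) then 1 else 0.
Definition addA (a b : coeff) : coeff := fun m n => a m n + b m n.
Definition oppA (a : coeff) : coeff := fun m n => - a m n.
Definition subA (a b : coeff) : coeff := fun m n => a m n - b m n.
Definition scaleA (c : R[i]) (a : coeff) : coeff := fun m n => c * a m n.
Definition constA (c : R[i]) : coeff := scaleA c oneA.

(** Product in A_theta, using U1 U2 = e^{2 pi i theta} U2 U1, so that
    (U1^p U2^q)(U1^r U2^s) = e^{-2 pi i theta q r} U1^(p+r) U2^(q+s). *)
Definition mulA (theta : R) (a b : coeff) : coeff := fun m n =>
  zsum2 (fun p q => a p q * b (m - p) (n - q) * twist theta (- (q * (m - p)))).

Definition deltaA (tau : R[i]) (a : coeff) : coeff := fun m n =>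
  (2 * pi)%:C * 'i * (m%:~R * tau + n%:~R) * a m n.

Definition trA (a : coeff) : R[i] := a 0 0.

Definition right_module (theta : R) (E : zmodType) (act : E -> coeff -> E) : Prop :=
  [/\ forall e e' a, rapid a -> act (e + e') a = act e a + act e' a,
      forall e a b, rapid a -> rapid b -> act e (addA a b) = act e a + act e b,
      forall e, act e oneA = e &
      forall e a b, rapid a -> rapid b -> act (act e a) b = act e (mulA theta a b)].

Definition fg_projective (theta : R) (E : zmodType) (act : E -> coeff -> E) : Prop :=
  exists (n : nat) (i : E -> 'I_n -> coeff) (p : ('I_n -> coeff) -> E),
    [/\ forall e, rapid_vec (i e),
        forall e e', i (e + e') = (fun k => addA (i e k) (i e' k)),
        forall e a, rapid a -> i (act e a) = (fun k => mulA theta (i e k) a) &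
      [/\ forall v w, rapid_vec v -> rapid_vec w ->
          p (fun k => addA (v k) (w k)) = p v + p w,
        forall v a, rapid_vec v -> rapid a ->
          p (fun k => mulA theta (v k) a) = act (p v) a &
        forall e, p (i e) = e]].

Definition holomorphic_structure (tau : R[i]) (E : zmodType) (act : E -> coeff -> E)
    (nabla : E -> E) : Prop :=
  [/\ forall e e', nabla (e + e') = nabla e + nabla e',
      forall e c, nabla (act e (constA c)) = act (nabla e) (constA c) &
      forall e a, rapid a -> nabla (act e a) = act (nabla e) a + act e (deltaA tau a)].

Definition holomorphic_bundle (theta : R) (tau : R[i]) (E : zmodType)
    (act : E -> coeff -> E) (nabla : E -> E) : Prop :=
  [/\ right_module theta act, fg_projective theta act & holomorphic_structure tau act nabla].

Definition dual_elt (theta : R) (E : zmodType) (act : E -> coeff -> E) (f : E -> coeff) : Prop :=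
  [/\ forall e, rapid (f e),
      forall e e', f (e + e') = addA (f e) (f e') &
      forall e a, rapid a -> f (act e a) = mulA theta (f e) a].

Definition dual_add (E : Type) (f g : E -> coeff) : E -> coeff := fun e => addA (f e) (g e).
Definition dual_scale (E : Type) (c : R[i]) (f : E -> coeff) : E -> coeff :=
  fun e => scaleA c (f e).

Definition dual_nabla (tau : R[i]) (E : Type) (nabla : E -> E) (f : E -> coeff) : E -> coeff :=
  fun e => subA (deltaA tau (f e)) (f (nabla e)).

(** H^0(E) = ker nabla ; boundaries im nabla (H^1(E) = E / im nabla) *)
Definition H0_mem (E : zmodType) (nabla : E -> E) (e : E) : Prop := nabla e = 0.
Definition im_nabla (E : zmodType) (nabla : E -> E) (e : E) : Prop := exists e0, e = nabla e0.

(** H^0(E^v) = ker nabla^v ; boundaries im nabla^v (H^1(E^v) = E^v / im nabla^v) *)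
Definition H0v_mem (theta : R) (tau : R[i]) (E : zmodType) (act : E -> coeff -> E)
    (nabla : E -> E) (f : E -> coeff) : Prop :=
  dual_elt theta act f /\ forall e, dual_nabla tau nabla f e = zeroA.
Definition im_dual_nabla (theta : R) (tau : R[i]) (E : zmodType) (act : E -> coeff -> E)
    (nabla : E -> E) (f : E -> coeff) : Prop :=
  exists g, dual_elt theta act g /\ forall e, f e = dual_nabla tau nabla g e.

Definition Clinear_on_E (E : zmodType) (act : E -> coeff -> E) (psi : E -> R[i]) : Prop :=
  forall e e' c, psi (e + act e' (constA c)) = psi e + c * psi e'.

End NCTorus.

(* Main.v *)
(* The bundle E is a direct summand of a free module A^n, on which the connection of E
   and the Grassmann connection of the complement add up to an operator
   D = delta + omega, with omega a matrix acting by left multiplication. On Fourier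
   coefficients, D is a diagonal operator growing linearly (because tau is not real) plus
   a kernel decaying rapidly off the diagonal; elements of the dual bundle become row
   vectors, and dual_nabla becomes minus the transpose of D. Outside a finite set of
   frequencies the diagonal part dominates, so D and its transpose become surjective after
   a perturbation of finite rank, and what remains is the Fredholm alternative for a
   finite linear system. Perfectness for D descends to E by restricting along the
   inclusion E -> A^n and the projection A^n -> E. *)

Require Import Defs.
From HB Require Import structures.
From mathcomp Require Import all_boot all_order all_algebra.
From mathcomp Require Import all_classical all_reals all_analysis.
From mathcomp Require Import complex.
From mathcomp Require Import ring lra zify.
Import Order.TTheory GRing.Theory Num.Theory.
Import numFieldNormedType.Exports.
Set Implicit Arguments. Unset Strict Implicit. Unset Printing Implicit Defensive.
Local Open Scope ring_scope.
Local Open Scope complex_scope.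

(** * Unordered sums of complex families *)

(** No Hilbert or Sobolev space appears: the analysis runs on rapidly decreasing families, with sup
    bounds weighted by powers of 1 + |m| + |n|. The inequality [w x <= rho x y * w y] lets a kernel
    that decays in every power of [rho] preserve each order of decay, so a bounded solution of the
    exterior equation turns out to be rapid. The form [dot] is bilinear, not hermitian, because
    tr(f(e)) is; the partner of D is therefore its transpose, which satisfies the same estimates.
    The dual spaces are the full algebraic ones. This causes no trouble: by surjectivity up to
    finite rank, a functional that kills im D is determined by its values on finitely many delta
    functions, and ker T has finite dimension. The descent to E rests on D i = i nabla and p D =
    nabla p, that is, D respects the splitting of the free module. Finally, an element f of the dual
    is recovered from the scalars tr(f(e)) alone, since tr(f(e U^(-z))) is, up to a phase, the
    coefficient of f(e) at z; equalities in the dual bundle thus become equalities of numbers. *)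

Definition cnorm (R : realType) (z : R[i]) : R := Normc.normc z.

Section ComplexNorm.
Variable R : realType.
Implicit Types z w : R[i].

Lemma normcE z : `|z| = (cnorm z)%:C.
Proof. by case: z. Qed.

Lemma cnorm0 : cnorm (0 : R[i]) = 0. Proof. exact: Normc.normc0. Qed.

Lemma cnorm1 : cnorm (1 : R[i]) = 1. Proof. exact: Normc.normc1. Qed.

Lemma cnormM z w : cnorm (z * w) = cnorm z * cnorm w.
Proof. exact: Normc.normcM. Qed.

Lemma cnormD z w : cnorm (z + w) <= cnorm z + cnorm w.
Proof. exact: (le_normcD (z : Rcomplex R) w). Qed.

Lemma cnormN z : cnorm (- z) = cnorm z.
Proof. exact: (normcN (z : Rcomplex R)). Qed.

Lemma cnormB z w : cnorm (z - w) <= cnorm z + cnorm w.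
Proof. by rewrite -(cnormN w) cnormD. Qed.

Lemma cnormV z : cnorm z^-1 = (cnorm z)^-1.
Proof. exact: Normc.normcV. Qed.

Lemma cnorm_ge0 z : 0 <= cnorm z.
Proof. by case: z => a b; rewrite /cnorm /= sqrtr_ge0. Qed.

Lemma cnorm_eq0 z : cnorm z = 0 -> z = 0. Proof. exact: Normc.eq0_normc. Qed.

Lemma cnorm_real (x : R) : cnorm x%:C = `|x|.
Proof. by rewrite /cnorm /= expr0n /= addr0 sqrtr_sqr. Qed.

Lemma cnormB_real (x y : R) : cnorm (x%:C - y%:C) = `|x - y|.
Proof. by rewrite -cnorm_real; congr cnorm; simpc. Qed.

Lemma cnorm_gt0 z : (0 < cnorm z) = (z != 0).
Proof.
rewrite lt_def cnorm_ge0 andbT; congr negb.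
by apply/eqP/eqP => [/cnorm_eq0//|->]; rewrite cnorm0.
Qed.

Lemma cnorm_ge_Re z : `|complex.Re z| <= cnorm z.
Proof.
case: z => a b; rewrite /cnorm /= -sqrtr_sqr ler_sqrt ?lerDl ?sqr_ge0//.
by rewrite addr_ge0 ?sqr_ge0.
Qed.

Lemma cnorm_ge_Im z : `|complex.Im z| <= cnorm z.
Proof.
case: z => a b; rewrite /cnorm /= -sqrtr_sqr ler_sqrt ?lerDr ?sqr_ge0//.
by rewrite addr_ge0 ?sqr_ge0.
Qed.

Lemma cnorm_sum (I : Type) (s : seq I) (P : pred I) (F : I -> R[i]) :
  cnorm (\sum_(x <- s | P x) F x) <= \sum_(x <- s | P x) cnorm (F x).
Proof.
apply: (big_ind2 (fun a b => cnorm a <= b)); rewrite ?cnorm0//.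
by move=> a b c e h1 h2; apply: le_trans (cnormD _ _) (lerD h1 h2).
Qed.

Lemma cnorm_small z : (forall e, 0 < e -> cnorm z <= e) -> z = 0.
Proof.
move=> h; apply: cnorm_eq0; apply/eqP; rewrite eq_le cnorm_ge0 andbT.
by apply/ler_addgt0Pr => e e0; rewrite add0r; exact: h.
Qed.

End ComplexNorm.

(** Summability with the bound kept explicit, so that uniformity in a parameter, as in
    [kernel_rapid], can be expressed. *)
Definition sum_bound (R : realType) (X : eqType) (g : X -> R) (B : R) : Prop :=
  forall s : seq X, uniq s -> \sum_(x <- s) g x <= B.

Section SumBound.
Variable R : realType.

Lemma sum_bound_pt (X : eqType) (g : X -> R) B : sum_bound g B -> forall x, g x <= B.
Proof. by move=> h x; have := h [:: x] isT; rewrite big_seq1. Qed.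

Lemma sum_bound_le (X : eqType) (g h : X -> R) B :
  (forall x, g x <= h x) -> sum_bound h B -> sum_bound g B.
Proof. by move=> gh hB s us; apply: le_trans (hB s us); apply: ler_sum => x _. Qed.

Lemma sum_boundD (X : eqType) (g h : X -> R) A B :
  sum_bound g A -> sum_bound h B -> sum_bound (fun x => g x + h x) (A + B).
Proof. by move=> gA hB s us; rewrite big_split /= lerD ?gA ?hB. Qed.

Lemma sum_boundZ (X : eqType) (g : X -> R) B c : 0 <= c ->
  sum_bound g B -> sum_bound (fun x => c * g x) (c * B).
Proof. by move=> c0 gB s us; rewrite -mulr_sumr ler_wpM2l ?gB. Qed.

Lemma sum_bound_inj (X Y : eqType) (f : X -> Y) (g : Y -> R) B :
  injective f -> sum_bound g B -> sum_bound (fun x => g (f x)) B.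
Proof. by move=> fI gB s us; rewrite -(big_map f xpredT) gB ?map_inj_uniq. Qed.

Lemma sum_bound_fin (I : finType) (g : I -> R) :
  (forall i, 0 <= g i) -> sum_bound g (\sum_i g i).
Proof.
move=> g0 s us; rewrite big_uniq //= [leRHS](bigID (mem s)) /= lerDl.
exact: sumr_ge0.
Qed.

Lemma le_sum_sub (X : eqType) (g : X -> R) (s t : seq X) :
  (forall x, 0 <= g x) -> uniq s -> uniq t -> {subset s <= t} ->
  \sum_(x <- s) g x <= \sum_(x <- t) g x.
Proof.
move=> g0 us ut st; rewrite [leRHS](bigID (mem s)) /= -[X in _ <= X + _]big_filter.
have E : perm_eq [seq i <- t | i \in s] s.
  apply: uniq_perm; rewrite ?filter_uniq// => x; rewrite mem_filter /=.
  by apply/andP/idP => [[]//|xs]; split=> //; exact: st.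
by rewrite (perm_big _ E) lerDl sumr_ge0.
Qed.

(** A finite set of pairs lies in the product of its two projections, and over that product the sum
    factors. *)
Lemma sum_bound_prod (X Y : eqType) (g : X -> R) (h : Y -> R) A B :
  (forall x, 0 <= g x) -> (forall y, 0 <= h y) -> sum_bound g A -> sum_bound h B ->
  sum_bound (fun z : X * Y => g z.1 * h z.2) (A * B).
Proof.
move=> g0 h0 gA hB s us.
pose s1 := undup (map fst s); pose s2 := undup (map snd s).
apply: le_trans (_ : \sum_(z <- [seq (x, y) | x <- s1, y <- s2]) g z.1 * h z.2 <= _).
  apply: le_sum_sub => //; first by move=> z; rewrite mulr_ge0.
    by apply: allpairs_uniq; rewrite ?undup_uniq// => -[? ?] [? ?].
  move=> [x y] xys; apply/allpairsP; exists (x, y); split=> //=;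
    by rewrite mem_undup; apply/mapP; exists (x, y).
rewrite big_allpairs_dep /=.
under eq_bigr do rewrite -mulr_sumr.
rewrite -mulr_suml ler_pM ?gA ?hB ?undup_uniq//; exact: sumr_ge0.
Qed.

Lemma sum_bound_geom (C : R) : 0 <= C ->
  sum_bound (fun n : nat => C * (2^-1) ^+ n) (C * 2).
Proof.
move=> C0; apply: sum_boundZ => // s us.
pose N := (\max_(n <- s) n).+1.
apply: le_trans (_ : \sum_(n <- iota 0 N) (2^-1) ^+ n <= _).
  apply: le_sum_sub => //; first exact: iota_uniq.
  by move=> n ns; rewrite mem_iota /= add0n ltnS leq_bigmax_seq.
suff -> : \sum_(n <- iota 0 N) (2^-1) ^+ n = 2 - 2 * (2^-1) ^+ N :> R.
  by rewrite gerBl mulr_ge0// exprn_ge0 ?invr_ge0.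
elim: {s us} N => [|N IH]; first by rewrite big_nil expr0; ring.
by rewrite -addn1 iotaD big_cat /= IH big_seq1 add0n addn1 exprS; field.
Qed.

End SumBound.

(* Convergence along finite subsets rather than along squares makes reindexing by
   bijections immediate; [zsum2E] recovers the sums over squares. *)
Definition has_sum (R : realType) (X : eqType) (F : X -> R[i]) (l : R[i]) : Prop :=
  forall e : R, 0 < e -> exists2 s0 : seq X, uniq s0 &
    forall s, uniq s -> {subset s0 <= s} -> cnorm (\sum_(x <- s) F x - l) <= e.

Definition total (R : realType) (X : eqType) (F : X -> R[i]) : R[i] :=
  xget 0 [set l | has_sum F l].

Definition summable (R : realType) (X : eqType) (F : X -> R[i]) : Prop :=
  exists B, sum_bound (fun x => cnorm (F x)) B.

Section Total.
Variable R : realType.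

Lemma has_sum_unique (X : eqType) (F : X -> R[i]) l l' :
  has_sum F l -> has_sum F l' -> l = l'.
Proof.
move=> h h'; apply/eqP; rewrite -subr_eq0; apply/eqP/cnorm_small => e e0.
have [s us hs] := h (e / 2) ltac:(lra); have [s' us' hs'] := h' (e / 2) ltac:(lra).
have ut := undup_uniq (s ++ s').
have h1 := hs _ ut; have h2 := hs' _ ut.
have {}h1 := h1 ltac:(by move=> x xs; rewrite mem_undup mem_cat xs).
have {}h2 := h2 ltac:(by move=> x xs; rewrite mem_undup mem_cat xs orbT).
set S := (\sum_(x <- _) _) in h1 h2.
have -> : l - l' = (S - l') - (S - l) by ring.
by apply: le_trans (cnormB _ _) _; lra.
Qed.

Lemma total_eq (X : eqType) (F : X -> R[i]) l : has_sum F l -> total F = l.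
Proof.
move=> h; apply: (@has_sum_unique _ F) => //.
by rewrite /total; case: xgetP => [l' _//|/(_ l)/(_ h)].
Qed.

Lemma has_sumD (X : eqType) (F G : X -> R[i]) l m :
  has_sum F l -> has_sum G m -> has_sum (fun x => F x + G x) (l + m).
Proof.
move=> h h' e e0.
have [s us hs] := h (e / 2) ltac:(lra); have [s' us' hs'] := h' (e / 2) ltac:(lra).
exists (undup (s ++ s')); first exact: undup_uniq.
move=> t ut st.
have h1 := hs _ ut; have h2 := hs' _ ut.
have {}h1 := h1 ltac:(by move=> x xs; apply: st; rewrite mem_undup mem_cat xs).
have {}h2 := h2 ltac:(by move=> x xs; apply: st; rewrite mem_undup mem_cat xs orbT).
rewrite big_split /= (_ : _ - _ = (\sum_(x <- t) F x - l) + (\sum_(x <- t) G x - m)).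
  by apply: le_trans (cnormD _ _) _; lra.
by ring.
Qed.

Lemma has_sumZ (X : eqType) (F : X -> R[i]) l c :
  has_sum F l -> has_sum (fun x => c * F x) (c * l).
Proof.
move=> h e e0; have c0 := cnorm_ge0 c.
have c1 : 0 < cnorm c + 1 by lra.
have [s us hs] := h (e / (cnorm c + 1)) ltac:(by apply: divr_gt0).
exists s => // t ut st; rewrite -mulr_sumr -mulrBr cnormM.
apply: le_trans (ler_wpM2l c0 (hs t ut st)) _.
by rewrite mulrA ler_pdivrMr//; nra.
Qed.

Lemma has_sum_ge0 (X : eqType) (g : X -> R) B :
  (forall x, 0 <= g x) -> sum_bound g B -> exists l : R, has_sum (fun x => (g x)%:C) l%:C.
Proof.
move=> g0 gB.
pose A := [set S | exists2 s : seq X, uniq s & S = \sum_(x <- s) g x]%classic.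
have supA : has_sup A.
  split; first by exists (\sum_(x <- [::]) g x); exists [::].
  by exists B => _ [s us ->]; exact: gB.
exists (sup A) => e e0.
have [_ [s us ->] hs] := sup_adherent e0 supA.
exists s => // t ut st.
have -> : \sum_(x <- t) (g x)%:C = (\sum_(x <- t) g x)%:C by rewrite rmorph_sum.
rewrite cnormB_real ler_norml; apply/andP; split.
  by have := le_sum_sub g0 us ut st; lra.
have : \sum_(x <- t) g x <= sup A by apply: ub_le_sup; [case: supA|exists t].
by lra.
Qed.

Lemma summable_has_sum (X : eqType) (F : X -> R[i]) :
  summable F -> exists l, has_sum F l.
Proof.
move=> [B hB]; pose g x := cnorm (F x).
have g0 x : 0 <= g x by exact: cnorm_ge0.
(* A real family dominated by [g] is the difference of the nonnegative families [f + g] and [g], to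
   which [has_sum_ge0] applies. *)
have aux (f : X -> R) : (forall x, `|f x| <= g x) -> exists l, has_sum (fun x => (f x)%:C) l.
  move=> fg.
  have [l1 h1] := has_sum_ge0 g0 hB.
  have [l2 h2] : exists l : R, has_sum (fun x => (f x + g x)%:C) l%:C.
    apply: (@has_sum_ge0 _ _ (B + B)).
      by move=> x; move: (fg x); rewrite ler_norml => /andP[]; lra.
    apply: (sum_bound_le _ (sum_boundD hB hB)) => x.
    by move: (fg x); rewrite ler_norml => /andP[] _; rewrite /g; lra.
  exists (l2%:C + (-1) * l1%:C).
  rewrite (_ : (fun x => _) = fun x => (f x + g x)%:C + (-1) * (g x)%:C).
    exact: has_sumD h2 (has_sumZ _ h1).
  by apply/funext => x; rewrite rmorphD /=; ring.
have [l1 h1] := aux (fun x => complex.Re (F x)) (fun x => cnorm_ge_Re _).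
have [l2 h2] := aux (fun x => complex.Im (F x)) (fun x => cnorm_ge_Im _).
exists (l1 + 'i * l2).
rewrite (_ : F = fun x => (complex.Re (F x))%:C + 'i * (complex.Im (F x))%:C).
  exact: has_sumD h1 (has_sumZ _ h2).
by apply/funext => x; rewrite -complexE.
Qed.

Lemma totalP (X : eqType) (F : X -> R[i]) : summable F -> has_sum F (total F).
Proof. by move=> /summable_has_sum[l hl]; rewrite (total_eq hl). Qed.

Lemma summable_le (X : eqType) (F : X -> R[i]) (g : X -> R) B :
  (forall x, cnorm (F x) <= g x) -> sum_bound g B -> summable F.
Proof. by move=> Fg gB; exists B; exact: sum_bound_le Fg gB. Qed.

Lemma summableZ (X : eqType) (F : X -> R[i]) c :
  summable F -> summable (fun x => c * F x).
Proof.
move=> [A hA]; apply: (summable_le _ (sum_boundZ (cnorm_ge0 c) hA)) => x.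
by rewrite cnormM.
Qed.

Lemma totalD (X : eqType) (F G : X -> R[i]) : summable F -> summable G ->
  total (fun x => F x + G x) = total F + total G.
Proof. by move=> hF hG; apply/total_eq/has_sumD; exact: totalP. Qed.

Lemma totalZ (X : eqType) (F : X -> R[i]) c : summable F ->
  total (fun x => c * F x) = c * total F.
Proof. by move=> hF; apply/total_eq/has_sumZ; exact: totalP. Qed.

Lemma total_norm_le (X : eqType) (F : X -> R[i]) B :
  sum_bound (fun x => cnorm (F x)) B -> cnorm (total F) <= B.
Proof.
move=> hB; have hF : summable F by exists B.
apply/ler_addgt0Pr => e e0; have [s us hs] := totalP hF e0.
have {}hs := hs s us (fun _ => id).
have -> : total F = \sum_(x <- s) F x - (\sum_(x <- s) F x - total F) by ring.
apply: le_trans (cnormB _ _) _; apply: lerD => //.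
by apply: le_trans (cnorm_sum _ _ _) _; exact: hB.
Qed.

Lemma total_le (X : eqType) (F : X -> R[i]) (g : X -> R) B :
  (forall x, cnorm (F x) <= g x) -> sum_bound g B -> cnorm (total F) <= B.
Proof. by move=> Fg gB; apply: total_norm_le; exact: sum_bound_le Fg gB. Qed.

Lemma has_sum_supp (X : eqType) (F : X -> R[i]) (s : seq X) : uniq s ->
  (forall x, x \notin s -> F x = 0) -> has_sum F (\sum_(x <- s) F x).
Proof.
move=> us F0 e e0; exists s => // t ut st.
rewrite [X in X - _](bigID (mem s)) /= [X in _ + X - _]big1 // addr0 -big_filter.
rewrite (@perm_big _ _ _ _ _ s) ?subrr ?cnorm0 ?ltW//.
apply: uniq_perm; rewrite ?filter_uniq// => x; rewrite mem_filter /=.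
by apply/andP/idP => [[]//|xs]; split=> //; exact: st.
Qed.

Lemma total_supp1 (X : eqType) (F : X -> R[i]) x :
  (forall y, y != x -> F y = 0) -> total F = F x.
Proof.
move=> F0; rewrite -[RHS](big_seq1 +%R x F); apply/total_eq/has_sum_supp => // y.
by rewrite inE; exact: F0.
Qed.

Lemma total_fin (I : finType) (F : I -> R[i]) : total F = \sum_i F i.
Proof.
have -> : \sum_i F i = \sum_(i <- enum I) F i by rewrite big_enum.
by apply/total_eq/has_sum_supp; [exact: enum_uniq|move=> x; rewrite mem_enum].
Qed.

Lemma has_sum_bij (X Y : eqType) (f : X -> Y) (g : Y -> X) (F : Y -> R[i]) l :
  cancel f g -> cancel g f -> has_sum F l -> has_sum (fun x => F (f x)) l.
Proof.
move=> fK gK h e e0; have [s us hs] := h e e0.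
exists (map g s); first by rewrite map_inj_uniq //; exact: can_inj gK.
move=> t ut st; rewrite -(big_map f xpredT); apply: hs.
  by rewrite map_inj_uniq //; exact: can_inj fK.
move=> y ys; rewrite -(gK y); apply: map_f; apply: st; exact: map_f.
Qed.

Lemma total_bij (X Y : eqType) (f : X -> Y) (g : Y -> X) (F : Y -> R[i]) :
  cancel f g -> cancel g f -> summable F -> total (fun x => F (f x)) = total F.
Proof. by move=> fK gK hF; apply/total_eq/(has_sum_bij fK gK)/totalP. Qed.

(** Splitting off the first term is what yields the fixed point equation of the Neumann series in
    [exterior_solve]. *)
Lemma has_sum_S (F : nat -> R[i]) l :
  has_sum (fun n => F n.+1) l -> has_sum F (F 0%N + l).
Proof.
move=> h e e0; have [s us hs] := h e e0.
exists (0%N :: map S s); first by rewrite /= map_inj_uniq ?us ?andbT;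
  [apply/negP => /mapP[]|exact: succn_inj].
move=> t ut st.
have t0 : 0%N \in t by apply: st; rewrite inE.
rewrite (perm_big _ (perm_to_rem t0)) big_cons opprD addrACA subrr add0r.
pose t' := map predn (rem 0%N t).
have tE : rem 0%N t = map S t'.
  rewrite -map_comp -[LHS]map_id; apply/eq_in_map => -[|n] //=.
  by rewrite mem_rem_uniq// inE.
rewrite tE big_map; apply: hs.
  by rewrite -(map_inj_uniq succn_inj) -tE rem_uniq.
move=> n ns; rewrite -(mem_map succn_inj) -tE mem_rem_uniq// inE /=.
by apply: st; rewrite inE /= map_f.
Qed.

Lemma total_S (F : nat -> R[i]) : summable (fun n => F n.+1) ->
  total F = F 0%N + total (fun n => F n.+1).
Proof. by move=> h; apply/total_eq/has_sum_S/totalP. Qed.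

Lemma summable_sect (X Y : eqType) (F : X * Y -> R[i]) x :
  summable F -> summable (fun y => F (x, y)).
Proof.
move=> [B hB]; exists B; apply: (@sum_bound_inj _ _ _ (fun y => (x, y)) _ _ _ hB).
by move=> y y' [].
Qed.

(** The sum over a rectangle [A] times [B] is compared with both sides. [B] has to contain the
    second coordinates of a finite set controlling the whole sum, and also a good approximating set
    for each of the finitely many rows in [A]. *)
Lemma has_sum_pair (X Y : eqType) (F : X * Y -> R[i]) : summable F ->
  has_sum (fun x => total (fun y => F (x, y))) (total F).
Proof.
move=> hF e e0; have e2 : 0 < e / 2 by lra.
have [s us hs] := totalP hF e2.
exists (undup (map fst s)); first exact: undup_uniq.
move=> A uA sA.
(* Each row gets an equal share of the error [e / 2]; the successor keeps the divisor positive when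
   [A] is empty. *)
have n0 : 0 < (size A).+1%:R :> R by rewrite ltr0n.
have d0 : 0 < e / 2 / (size A).+1%:R by apply: divr_gt0.
have /choice[b hb] : forall x, exists b : seq Y, forall B, uniq B -> {subset b <= B} ->
    cnorm (\sum_(y <- B) F (x, y) - total (fun y => F (x, y))) <= e / 2 / (size A).+1%:R.
  by move=> x; have [b _ h] := totalP (summable_sect x hF) d0; exists b.
pose B := undup (map snd s ++ flatten (map b A)).
have uB : uniq B by exact: undup_uniq.
have h1 : cnorm (\sum_(x <- A) \sum_(y <- B) F (x, y) - total F) <= e / 2.
  have -> : \sum_(x <- A) \sum_(y <- B) F (x, y) =
      \sum_(z <- [seq (x, y) | x <- A, y <- B]) F z by rewrite big_allpairs_dep.
  apply: hs; first by apply: allpairs_uniq => // -[? ?] [? ?].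
  move=> [x y] xys; apply/allpairsP; exists (x, y); split=> //=.
    by apply: sA; rewrite mem_undup; apply/mapP; exists (x, y).
  by rewrite mem_undup mem_cat; apply/orP; left; apply/mapP; exists (x, y).
have h2 : cnorm (\sum_(x <- A) \sum_(y <- B) F (x, y) -
                 \sum_(x <- A) total (fun y => F (x, y))) <= e / 2.
  rewrite -sumrB; apply: le_trans (cnorm_sum _ _ _) _.
  apply: le_trans (_ : \sum_(x <- A) e / 2 / (size A).+1%:R <= _).
    rewrite big_seq [leRHS]big_seq; apply: ler_sum => x xA; apply: hb => // y yb.
    by rewrite mem_undup mem_cat; apply/orP; right; apply/flattenP; exists (b x); rewrite ?map_f.
  rewrite big_const_seq count_predT iter_addr_0 -[leLHS]mulr_natr -mulrA ler_piMr//.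
    exact: ltW.
  by rewrite mulrC ler_pdivrMr// mul1r ler_nat.
set S1 := \sum_(x <- A) \sum_(y <- B) _ in h1 h2; set S2 := \sum_(x <- A) _ in h2 *.
have -> : S2 - total F = (S1 - total F) - (S1 - S2) by ring.
by apply: le_trans (cnormB _ _) _; lra.
Qed.

Lemma total_pair (X Y : eqType) (F : X * Y -> R[i]) : summable F ->
  total F = total (fun x => total (fun y => F (x, y))).
Proof. by move=> hF; rewrite (total_eq (has_sum_pair hF)). Qed.

(** Domination by a product makes [F] summable on pairs, and both iterated sums then equal the sum
    over pairs. *)
Lemma total_swap (X Y : eqType) (F : X -> Y -> R[i]) (g : X -> R) (h : Y -> R) A B :
  (forall x, 0 <= g x) -> (forall y, 0 <= h y) -> sum_bound g A -> sum_bound h B ->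
  (forall x y, cnorm (F x y) <= g x * h y) ->
  total (fun x => total (fun y => F x y)) = total (fun y => total (fun x => F x y)).
Proof.
move=> g0 h0 gA hB FgH.
have hF : summable (fun z : X * Y => F z.1 z.2).
  by apply: (summable_le _ (sum_bound_prod g0 h0 gA hB)) => z; exact: FgH.
rewrite -(total_pair hF).
have hG : summable (fun z : Y * X => F z.2 z.1).
  apply: (summable_le _ (sum_bound_prod h0 g0 hB gA)) => z.
  by rewrite [X in _ <= X]mulrC; exact: FgH.
rewrite -(total_pair hG) -(@total_bij _ _ (fun z : Y * X => (z.2, z.1))
  (fun z : X * Y => (z.2, z.1)) (fun z => F z.1 z.2)) //; by case.
Qed.

Lemma eq_total (X : eqType) (F G : X -> R[i]) : (forall x, F x = G x) -> total F = total G.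
Proof. by move=> FG; congr total; apply/funext. Qed.

Lemma total0 (X : eqType) : total (fun _ : X => 0 : R[i]) = 0.
Proof.
by apply/total_eq => e e0; exists [::] => // s _ _; rewrite big1 // subrr cnorm0 ltW.
Qed.

End Total.

(** * The Fredholm alternative for finite rank perturbations *)

(* [D] and its transpose [T] become surjective after
   subtracting mutually transposed operators of finite rank, so solving
   [D v = g] amounts to solving a finite linear system whose matrix [Mmx] has left
   kernel isomorphic to [ker T]. *)
Section Fredholm.
Variables (K : fieldType) (V : lmodType K) (S : V -> Prop) (B : V -> V -> K).
Hypothesis S0 : S 0.
Hypothesis SL : forall c u v, S u -> S v -> S (c *: u + v).
Hypothesis Bl : forall c u v w, S u -> S v -> S w -> B (c *: u + v) w = c * B u w + B v w.
Hypothesis Br : forall c u v w, S u -> S v -> S w -> B w (c *: u + v) = c * B w u + B w v.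
Hypothesis Bnd : forall v, S v -> (forall w, S w -> B w v = 0) -> v = 0.
Hypothesis Bndl : forall w, S w -> (forall v, S v -> B w v = 0) -> w = 0.
Variables D T : V -> V.
Hypothesis SD : forall v, S v -> S (D v).
Hypothesis ST : forall v, S v -> S (T v).
Hypothesis adj : forall w v, S w -> S v -> B w (D v) = B (T w) v.
Variables (N : nat) (a b : 'I_N -> V).
Hypothesis Sa : forall j, S (a j).
Hypothesis Sb : forall j, S (b j).
Hypothesis Dsurj : forall g, S g -> exists2 h, S h & D h = g + \sum_j B (b j) h *: a j.
Hypothesis Tsurj : forall g, S g -> exists2 h, S h & T h = g + \sum_j B h (a j) *: b j.

Let SZ c u : S u -> S (c *: u).
Proof. by move=> Su; rewrite -[X in S X]addr0; exact: SL. Qed.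

Let SDv u v : S u -> S v -> S (u + v).
Proof. by move=> Su Sv; rewrite -[u]scale1r; exact: SL. Qed.

Let Ssum (I : Type) (r : seq I) (f : I -> V) : (forall i, S (f i)) -> S (\sum_(i <- r) f i).
Proof. by move=> h; apply: big_ind => // *; exact: SDv. Qed.

Let Ssc (n : nat) (c : 'I_n -> K) (f : 'I_n -> V) :
  (forall i, S (f i)) -> S (\sum_i c i *: f i).
Proof. by move=> h; apply: Ssum => i; exact: SZ. Qed.

Let B0l v : S v -> B 0 v = 0.
Proof. by move=> Sv; have := Bl (-1) S0 S0 Sv; rewrite scaler0 addr0 mulN1r addNr. Qed.

Let B0r v : S v -> B v 0 = 0.
Proof. by move=> Sv; have := Br (-1) S0 S0 Sv; rewrite scaler0 addr0 mulN1r addNr. Qed.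

Let BlD u v w : S u -> S v -> S w -> B (u + v) w = B u w + B v w.
Proof. by move=> Su Sv Sw; rewrite -{1}[u]scale1r Bl // mul1r. Qed.

Let BrD u v w : S u -> S v -> S w -> B w (u + v) = B w u + B w v.
Proof. by move=> Su Sv Sw; rewrite -{1}[u]scale1r Br // mul1r. Qed.

Let Blsum n (c : 'I_n -> K) (f : 'I_n -> V) v : (forall i, S (f i)) -> S v ->
  B (\sum_i c i *: f i) v = \sum_i c i * B (f i) v.
Proof.
move=> h Sv.
elim: n c f h => [|n IH] c f h; first by rewrite !big_ord0 B0l.
by rewrite !big_ord_recl Bl ?IH //; exact: Ssc.
Qed.

Let Brsum n (c : 'I_n -> K) (f : 'I_n -> V) v : (forall i, S (f i)) -> S v ->
  B v (\sum_i c i *: f i) = \sum_i c i * B v (f i).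
Proof.
move=> h Sv.
elim: n c f h => [|n IH] c f h; first by rewrite !big_ord0 B0r.
by rewrite !big_ord_recl Br ?IH //; exact: Ssc.
Qed.

Let Beq u v : S u -> S v -> (forall w, S w -> B w u = B w v) -> u = v.
Proof.
move=> Su Sv h; apply/eqP; rewrite -subr_eq0; apply/eqP/Bnd.
  by rewrite addrC -scaleN1r; exact: SL.
by move=> w Sw; rewrite addrC -scaleN1r Br // h // mulN1r addNr.
Qed.

Let Beql u v : S u -> S v -> (forall w, S w -> B u w = B v w) -> u = v.
Proof.
move=> Su Sv h; apply/eqP; rewrite -subr_eq0; apply/eqP/Bndl.
  by rewrite addrC -scaleN1r; exact: SL.
by move=> w Sw; rewrite addrC -scaleN1r Bl // h // mulN1r addNr.
Qed.

(** Linearity comes for free from the adjunction with [T] and the nondegeneracy of [B]. *)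
Let Dlin c u v : S u -> S v -> D (c *: u + v) = c *: D u + D v.
Proof.
move=> Su Sv; apply: Beq => [||w Sw]; try by do ?[apply: SD|apply: SL].
by rewrite Br ?adj ?Br //; [exact: ST|exact: SL|exact: SD|exact: SD].
Qed.

Let Tlin c u v : S u -> S v -> T (c *: u + v) = c *: T u + T v.
Proof.
move=> Su Sv; apply: Beql => [||w Sw]; try by do ?[apply: ST|apply: SL].
by rewrite Bl -?adj ?Bl //; [exact: SD|exact: SL|exact: ST|exact: ST].
Qed.

Let Dsum n (c : 'I_n -> K) (f : 'I_n -> V) : (forall i, S (f i)) ->
  D (\sum_i c i *: f i) = \sum_i c i *: D (f i).
Proof.
move=> h; apply: Beq => [||w Sw]; [by apply/SD/Ssc|by apply: Ssc => i; exact: SD|].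
rewrite adj ?Brsum //; [|by move=> i; exact: SD|exact: ST|exact: Ssc].
by apply: eq_bigr => i _; rewrite adj.
Qed.

Let Tsum n (c : 'I_n -> K) (f : 'I_n -> V) : (forall i, S (f i)) ->
  T (\sum_i c i *: f i) = \sum_i c i *: T (f i).
Proof.
move=> h; apply: Beql => [||w Sw]; [by apply/ST/Ssc|by apply: Ssc => i; exact: ST|].
rewrite -adj ?Blsum //; [|by move=> i; exact: ST|exact: SD|exact: Ssc].
by apply: eq_bigr => i _; rewrite adj.
Qed.

Let exist_alpha : exists al : 'I_N -> V, forall j,
  S (al j) /\ D (al j) = a j + \sum_k B (b k) (al j) *: a k.
Proof.
have /choice[al h] : forall j, exists v, S v /\ D v = a j + \sum_k B (b k) v *: a k.
  by move=> j; have [v Sv h] := Dsurj (Sa j); exists v.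
by exists al.
Qed.

Let exist_beta : exists be : 'I_N -> V, forall j,
  S (be j) /\ T (be j) = b j + \sum_k B (be j) (a k) *: b k.
Proof.
have /choice[al h] : forall j, exists v, S v /\ T v = b j + \sum_k B v (a k) *: b k.
  by move=> j; have [v Sv h] := Tsurj (Sb j); exists v.
by exists al.
Qed.

Section Beta.
Variable be : 'I_N -> V.
Hypothesis beP : forall j, S (be j) /\ T (be j) = b j + \sum_k B (be j) (a k) *: b k.

Let Sbe j : S (be j). Proof. by case: (beP j). Qed.

(** Row [j] holds the coefficients of [T (be j)] on the [b k]. By [pairing_beta], column [j] holds
    those of [D (al j)] on the [a k], where [al j] is a preimage of [a j] under the perturbed
    [D]. *)
Let Mmx : 'M[K]_N := \matrix_(j, k) ((j == k)%:R + B (be j) (a k)).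

(** Expanding both sides of [B (be j) (D h) = B (T (be j)) h] produces the same finite rank term
    twice, and it cancels. *)
Let pairing_beta j h g : S h -> S g -> D h = g + \sum_k B (b k) h *: a k ->
  B (be j) g = B (b j) h.
Proof.
move=> Sh Sg Dh; have := adj (Sbe j) Sh.
rewrite (beP j).2 Dh BrD //; last exact: Ssc.
rewrite BlD ?Brsum ?Blsum //; last exact: Ssc.
rewrite (eq_bigr (fun k => B (be j) (a k) * B (b k) h)); first exact: addIr.
by move=> k _; rewrite mulrC.
Qed.

Let kerM_ker (r : 'rV[K]_N) : r *m Mmx = 0 -> T (\sum_j r 0 j *: be j) = 0.
Proof.
move=> rM; rewrite Tsum //.
under eq_bigr do rewrite (beP _).2 scalerDr scaler_sumr.
rewrite big_split /= exchange_big /= -big_split /= big1 // => k _.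
under eq_bigr do rewrite scalerA.
rewrite -scaler_suml -scalerDl.
have E : \sum_j r 0 j * Mmx j k = 0 by have /matrixP/(_ 0 k) := rM; rewrite !mxE.
suff -> : r 0 k + \sum_i r 0 i * B (be i) (a k) = \sum_j r 0 j * Mmx j k.
  by rewrite E scale0r.
under [RHS]eq_bigr do rewrite mxE mulrDr.
rewrite big_split /=; congr (_ + _).
rewrite (bigD1 k) //= eqxx mulr1 big1 ?addr0 // => i ik.
by rewrite (negPf ik) mulr0.
Qed.

(** For [g] with perturbed preimage [h], [0 = B w (D h)] expresses [B w g] through the numbers
    [B w (a k)] and [B (b k) h = B (be k) g]. Nondegeneracy then gives the expansion of [w], and
    pairing that expansion with [a k] gives the matrix equation. *)
Let ker_repr w : S w -> T w = 0 ->
  w = \sum_j (- B w (a j)) *: be j /\ (\row_j - B w (a j)) *m Mmx = 0.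
Proof.
move=> Sw Tw.
have wE : w = \sum_j (- B w (a j)) *: be j.
  apply: Beql => [||v Sv] //; first exact: Ssc.
  have [h Sh Dh] := Dsurj Sv.
  rewrite Blsum //.
  under eq_bigr do rewrite (pairing_beta _ Sh Sv Dh).
  have := adj Sw Sh; rewrite Tw B0l // Dh BrD //; last exact: Ssc.
  rewrite Brsum // => /eqP; rewrite addr_eq0 => /eqP ->.
  by rewrite -sumrN; apply: eq_bigr => k _; rewrite mulrC mulNr.
split=> //; apply/rowP => k; rewrite !mxE.
under eq_bigr do rewrite !mxE mulrDr.
rewrite big_split /= (bigD1 k) //= eqxx mulr1 big1 ?addr0; last first.
  by move=> i ik; rewrite (negPf ik) mulr0.
apply/eqP; rewrite addrC subr_eq0; apply/eqP.
by rewrite {2}wE Blsum.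
Qed.

Lemma fredholm_solve_beta g : S g -> (forall w, S w -> T w = 0 -> B w g = 0) ->
  exists2 v, S v & D v = g.
Proof.
move=> Sg gK; have [al alP] := exist_alpha.
have Sal j : S (al j) by case: (alP j).
have [h Sh Dh] := Dsurj Sg.
pose c0 := \row_j B (be j) g.
(* The solution is sought as [h] minus a combination of the [al j] with coefficients [c]. Comparing
   the coefficients of the [a k] gives the system [c *m Mmx^T = c0], which is solvable once [c0] is
   orthogonal to the left kernel of [Mmx], hence once [g] is orthogonal to [ker T]. *)
have sub : (c0 <= Mmx^T)%MS.
  rewrite submxE; apply/eqP/rowP => i; rewrite !mxE.
  pose r := (col i (cokermx Mmx^T))^T.
  have rM : r *m Mmx = 0.
    by rewrite -[Mmx]trmxK -trmx_mul colE mulmxA mulmx_coker mul0mx trmx0.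
  have := gK _ (Ssc (fun j => r 0 j) Sbe) (kerM_ker rM).
  rewrite Blsum // => h0; rewrite -[RHS]h0; apply: eq_bigr => j _.
  by rewrite !mxE mulrC.
have /submxP[c /rowP cE] := sub.
exists (h - \sum_j c 0 j *: al j).
  by rewrite addrC -scaleN1r; apply: SL => //; exact: Ssc.
rewrite addrC -scaleN1r Dlin //; last exact: Ssc.
rewrite Dsum // Dh scaleN1r addrCA -[RHS]addr0; congr (_ + _).
under eq_bigr do rewrite (alP _).2 scalerDr scaler_sumr.
rewrite big_split /= exchange_big /= -big_split /= addrC -sumrB big1 // => k _.
under eq_bigr do rewrite scalerA.
rewrite -scaler_suml -scalerDl -scalerBl.
suff -> : B (b k) h = c 0 k + \sum_i c 0 i * B (b k) (al i) by rewrite subrr scale0r.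
rewrite -(pairing_beta k Sh Sg Dh); have := cE k; rewrite !mxE => ->.
under eq_bigr do rewrite !mxE mulrDr.
rewrite big_split /= (bigD1 k) //= eqxx mulr1 big1 ?addr0; last first.
  by move=> i ik; rewrite eq_sym (negPf ik) mulr0.
congr (_ + _); apply: eq_bigr => i _.
by rewrite -(pairing_beta k (Sal i) (Sa i)) ?(alP i).2.
Qed.

Lemma fredholm_ker_dual_beta (phi : V -> K) :
  (forall c u v, S u -> S v -> T u = 0 -> T v = 0 -> phi (c *: u + v) = c * phi u + phi v) ->
  exists2 v, S v & forall w, S w -> T w = 0 -> phi w = B w v.
Proof.
move=> phiL; pose kM := kermx Mmx.
pose wr (r : 'rV[K]_N) := \sum_j r 0 j *: be j.
have Swr r : S (wr r) by exact: Ssc.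
have kerrow i : row i kM *m Mmx = 0 by rewrite -row_mul mulmx_ker row0.
(* Seen on the left kernel of [Mmx], [phi] is a linear form known on the spanning rows of [kM]; the
   pseudoinverse extends it to all row vectors as multiplication by the column [c]. An element [w]
   of [ker T] has coordinates [- B w (a j)], whence the sign in the vector given below. *)
pose c := pinvmx kM *m \col_i phi (wr (row i kM)).
have phi0 : phi 0 = 0.
  have T0 : T 0 = 0 by have := Tlin (-1) S0 S0; rewrite scaler0 addr0 scaleN1r addNr.
  by have := phiL (-1) _ _ S0 S0 T0 T0; rewrite scaler0 addr0 mulN1r addNr.
have phisum n (d : 'I_n -> K) (f : 'I_n -> V) : (forall i, S (f i)) ->
    (forall i, T (f i) = 0) -> phi (\sum_i d i *: f i) = \sum_i d i * phi (f i).
  elim: n d f => [|n IH] d f Sf Tf; first by rewrite !big_ord0.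
  rewrite !big_ord_recl phiL //; first by rewrite IH.
    exact: Ssc.
  by rewrite Tsum // big1 // => i _; rewrite Tf scaler0.
exists (\sum_j (- c j 0) *: a j); first exact: Ssc.
move=> w Sw Tw; have [wE rM] := ker_repr Sw Tw.
set r := \row_j _ in rM.
have rk : (r <= kM)%MS by apply/sub_kermxP.
have wE2 : w = \sum_i (r *m pinvmx kM) 0 i *: wr (row i kM).
  rewrite {1}wE; under [RHS]eq_bigr do rewrite scaler_sumr.
  rewrite exchange_big /=; apply: eq_bigr => j _.
  under eq_bigr do rewrite scalerA.
  rewrite -scaler_suml; congr (_ *: _).
  have /rowP/(_ j) := mulmxKpV rk; rewrite !mxE => <-.
  by apply: eq_bigr => i _; congr (_ * _); rewrite [RHS]mxE.
rewrite {1}wE2 phisum //; last by move=> i; exact: kerM_ker.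
transitivity (\sum_j r 0 j * c j 0).
  transitivity ((r *m c) 0 0); last by rewrite [LHS]mxE.
  have -> : r *m c = (r *m pinvmx kM) *m \col_i phi (wr (row i kM)).
    exact: mulmxA.
  by rewrite [RHS]mxE; apply: eq_bigr => i _; congr (_ * _); rewrite [RHS]mxE.
rewrite Brsum //.
by apply: eq_bigr => j _; rewrite [r 0 j]mxE mulrC mulNr mulrN.
Qed.

(** Applying [psi] to [D h = g + \sum_j B (b j) h *: a j] gives [psi g] as minus the sum of the
    [B (b j) h * psi (a j)], and [pairing_beta] turns [B (b j) h] into [B (be j) g]. *)
Lemma fredholm_coker_dual_beta (psi : V -> K) :
  (forall c u v, S u -> S v -> psi (c *: u + v) = c * psi u + psi v) ->
  (forall v, S v -> psi (D v) = 0) ->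
  exists w, [/\ S w, T w = 0 & forall v, S v -> psi v = B w v].
Proof.
move=> psiL psiD.
have psi0 : psi 0 = 0.
  by have := psiL (-1) _ _ S0 S0; rewrite scaler0 addr0 mulN1r addNr.
have psisum n (d : 'I_n -> K) (f : 'I_n -> V) : (forall i, S (f i)) ->
    psi (\sum_i d i *: f i) = \sum_i d i * psi (f i).
  elim: n d f => [|n IH] d f Sf; first by rewrite !big_ord0.
  by rewrite !big_ord_recl psiL //; [rewrite IH|exact: Ssc].
pose w := \sum_j (- psi (a j)) *: be j.
have Sw : S w by exact: Ssc.
have psiE g : S g -> psi g = B w g.
  move=> Sg; have [h Sh Dh] := Dsurj Sg.
  have := psiD h Sh; rewrite Dh -{1}[g]scale1r psiL //; last exact: Ssc.
  rewrite mul1r psisum // => /eqP; rewrite addr_eq0 => /eqP ->.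
  rewrite Blsum // -sumrN; apply: eq_bigr => j _.
  by rewrite (pairing_beta j Sh Sg Dh) mulrC mulNr.
exists w; split=> //; apply: Bndl; first exact: ST.
by move=> v Sv; rewrite -adj // -psiE ?psiD //; exact: SD.
Qed.

End Beta.

Lemma fredholm_solve g : S g -> (forall w, S w -> T w = 0 -> B w g = 0) ->
  exists2 v, S v & D v = g.
Proof. by have [be beP] := exist_beta; exact: fredholm_solve_beta beP g. Qed.

Lemma fredholm_ker_dual (phi : V -> K) :
  (forall c u v, S u -> S v -> T u = 0 -> T v = 0 -> phi (c *: u + v) = c * phi u + phi v) ->
  exists2 v, S v & forall w, S w -> T w = 0 -> phi w = B w v.
Proof. by have [be beP] := exist_beta; exact: fredholm_ker_dual_beta beP phi. Qed.

Lemma fredholm_coker_dual (psi : V -> K) :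
  (forall c u v, S u -> S v -> psi (c *: u + v) = c * psi u + psi v) ->
  (forall v, S v -> psi (D v) = 0) ->
  exists w, [/\ S w, T w = 0 & forall v, S v -> psi v = B w v].
Proof. by have [be beP] := exist_beta; exact: fredholm_coker_dual_beta beP psi. Qed.

End Fredholm.

(** * Diagonally dominated kernel operators *)

Definition rapid_fun (R : realType) (X : Type) (w : X -> R) (u : X -> R[i]) : Prop :=
  forall k : nat, exists M : R, forall x, cnorm (u x) * w x ^+ k <= M.

(** A Schur type condition on rows only: weighted row sums are bounded uniformly in [x], for every
    power of [rho]. Columns are handled by imposing it on the transposed kernel. *)
Definition kernel_rapid (R : realType) (X : eqType) (rho : X -> X -> R)
    (L : X -> X -> R[i]) : Prop :=
  forall k : nat, exists M : R, forall x,
    sum_bound (fun y => cnorm (L x y) * rho x y ^+ k) M.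

Definition kernel_op (R : realType) (X : eqType) (L : X -> X -> R[i])
    (u : X -> R[i]) : X -> R[i] := fun x => total (fun y => L x y * u y).

Definition elliptic_op (R : realType) (X : eqType) (d : X -> R[i]) (L : X -> X -> R[i])
    (u : X -> R[i]) : X -> R[i] := fun x => d x * u x + kernel_op L u x.

Definition dot (R : realType) (X : eqType) (u v : X -> R[i]) : R[i] :=
  total (fun x => u x * v x).

Definition delta_fun (R : realType) (X : eqType) (x : X) : X -> R[i] :=
  fun y => (y == x)%:R.

Section Elliptic.
Variables (R : realType) (X : eqType) (w : X -> R) (rho : X -> X -> R) (k0 : nat) (W : R).
Hypothesis w_ge1 : forall x, 1 <= w x.
Hypothesis rho_ge0 : forall x y, 0 <= rho x y.
Hypothesis peetre : forall x y, w x <= rho x y * w y.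
Hypothesis w_sum : sum_bound (fun x => (w x ^+ k0)^-1) W.
Hypothesis w_fin : forall A, exists2 s : seq X, uniq s & forall x, x \notin s -> A <= w x.
Variables (d : X -> R[i]) (c C : R).
Hypothesis c_gt0 : 0 < c.
Hypothesis d_le : forall x, cnorm (d x) <= C * w x.
(** The shift by 1 allows the diagonal to vanish at points of weight 1, as the symbol of the
    derivation does at frequency zero. *)
Hypothesis d_ge : forall x, c * (w x - 1) <= cnorm (d x).

Local Notation S := (rapid_fun w).
Local Notation V := (X -> (R[i])^o).

Let w_gt0 x : 0 < w x. Proof. by apply: lt_le_trans (w_ge1 x). Qed.

Let wX_gt0 x k : 0 < w x ^+ k. Proof. exact: exprn_gt0. Qed.

Lemma rapid_fun0 : S (0 : V).
Proof. by move=> k; exists 0 => x; rewrite cnorm0 mul0r. Qed.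

Lemma rapid_fun_lin a (u v : V) : S u -> S v -> S (a *: u + v).
Proof.
move=> Su Sv k; have [M hM] := Su k; have [N hN] := Sv k.
exists (cnorm a * M + N) => x.
apply: le_trans (_ : (cnorm a * cnorm (u x) + cnorm (v x)) * w x ^+ k <= _).
  apply: ler_wpM2r; first exact: ltW.
  by rewrite -cnormM; exact: cnormD.
rewrite mulrDl -mulrA; apply: lerD (hN x); apply: ler_wpM2l (hM x).
exact: cnorm_ge0.
Qed.

Lemma rapid_fun_delta x : S (delta_fun R x).
Proof.
move=> k; exists (w x ^+ k) => y; rewrite /delta_fun; case: eqP => [->|_].
  by rewrite cnorm1 mul1r.
by rewrite cnorm0 mul0r ltW.
Qed.

Lemma rapid_fun_bounded u : S u -> exists M, forall x, cnorm (u x) <= M.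
Proof. by move=> /(_ 0%N)[M hM]; exists M => x; have := hM x; rewrite expr0 mulr1. Qed.

Lemma rapid_fun_sum u : S u -> exists B, sum_bound (fun x => cnorm (u x)) B.
Proof.
move=> /(_ k0)[M hM].
exists (`|M| * W); apply: (sum_bound_le _ (sum_boundZ (normr_ge0 M) w_sum)) => x.
by rewrite ler_pdivlMr //; apply: le_trans (hM x) (ler_norm _).
Qed.

Lemma summable_mul (u v : X -> R[i]) B M : sum_bound (fun x => cnorm (u x)) B ->
  (forall x, cnorm (v x) <= M) -> summable (fun x => u x * v x).
Proof.
move=> uB vM.
apply: (@summable_le _ _ _ (fun x => `|M| * cnorm (u x)) _ _ (sum_boundZ (normr_ge0 M) uB)).
move=> x; rewrite cnormM mulrC ler_wpM2r ?cnorm_ge0//.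
exact: le_trans (vM x) (ler_norm _).
Qed.

Lemma summable_dot u v : S u -> S v -> summable (fun x => u x * v x).
Proof.
by move=> /rapid_fun_sum[B uB] /rapid_fun_bounded[M vM]; exact: summable_mul uB vM.
Qed.

Lemma dotC (u v : X -> R[i]) : dot u v = dot v u.
Proof. by apply: eq_total => x; rewrite mulrC. Qed.

Lemma dot_linl a (u v t : V) : S u -> S v -> S t ->
  dot (a *: u + v) t = a * dot u t + dot v t.
Proof.
move=> Su Sv St; have sut := summable_dot Su St; have svt := summable_dot Sv St.
rewrite -totalZ // -totalD //; last exact: summableZ.
by apply: eq_total => x; rewrite mulrA -mulrDl.
Qed.

Lemma dot_linr a (u v t : V) : S u -> S v -> S t ->
  dot t (a *: u + v) = a * dot t u + dot t v.
Proof. by move=> Su Sv St; rewrite ![dot t _]dotC dot_linl. Qed.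

Lemma dot_deltal x (v : X -> R[i]) : dot (delta_fun R x) v = v x.
Proof.
rewrite /dot (@total_supp1 _ _ _ x) /delta_fun ?eqxx ?mul1r // => y /negPf ->.
by rewrite mul0r.
Qed.

Lemma dot_deltar x (v : X -> R[i]) : dot v (delta_fun R x) = v x.
Proof. by rewrite dotC dot_deltal. Qed.

Lemma dot_nondeg (v : V) : S v -> (forall t, S t -> dot t v = 0) -> v = 0.
Proof.
move=> Sv h; apply/funext => x; rewrite -[LHS]dot_deltal h //.
exact: rapid_fun_delta.
Qed.

(** The factor [w x ^+ k] is split by [peetre] into [rho x y ^+ k], absorbed by the kernel, and
    [w y ^+ k], absorbed by [u]. The case [k = 0] is the sup norm estimate behind the Neumann
    series. *)
Lemma kernel_op_decay L u k M N x :
  sum_bound (fun y => cnorm (L x y) * rho x y ^+ k) N ->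
  (forall y, cnorm (u y) * w y ^+ k <= M) ->
  cnorm (kernel_op L u x) * w x ^+ k <= M * N.
Proof.
move=> hN hM; rewrite -ler_pdivlMr // mulrAC.
have M0 : 0 <= M by apply: le_trans (hM x); rewrite mulr_ge0 ?cnorm_ge0 ?ltW.
apply: (total_le _ (sum_boundZ _ hN)); last by rewrite divr_ge0 // ltW.
move=> y; rewrite cnormM mulrAC ler_pdivlMr //.
apply: le_trans (_ : cnorm (L x y) * cnorm (u y) * (rho x y * w y) ^+ k <= _).
  apply: ler_wpM2l; first by rewrite mulr_ge0 ?cnorm_ge0.
  by rewrite lerXn2r ?nnegrE ?mulr_ge0 ?peetre // ltW.
rewrite exprMn [X in X <= _](_ : _ = (cnorm (u y) * w y ^+ k) *
  (cnorm (L x y) * rho x y ^+ k)); last by ring.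
by apply: ler_wpM2r (hM y); rewrite mulr_ge0 ?cnorm_ge0 ?exprn_ge0.
Qed.

Lemma kernel_sum L : kernel_rapid rho L ->
  exists2 N : R, 0 < N & forall x, sum_bound (fun y => cnorm (L x y)) N.
Proof.
move=> /(_ 0%N)[N hN]; exists (`|N| + 1); first by have := normr_ge0 N; lra.
move=> x s us; have := hN x s us; under eq_bigr do rewrite expr0 mulr1.
by have := ler_norm N; lra.
Qed.

Lemma kernel_op_rapid L u : kernel_rapid rho L -> S u -> S (kernel_op L u).
Proof.
move=> KL Su k; have [M hM] := Su k; have [N hN] := KL k.
by exists (M * N) => x; exact: kernel_op_decay.
Qed.

Lemma diag_rapid u : S u -> S (fun x => d x * u x).
Proof.
move=> Su k; have [M hM] := Su k.+1; exists (`|C| * M) => x.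
rewrite cnormM.
apply: le_trans (_ : `|C| * w x * cnorm (u x) * w x ^+ k <= _).
  apply: ler_wpM2r; first exact: ltW.
  apply: ler_wpM2r; first exact: cnorm_ge0.
  by apply: le_trans (d_le x) _; apply: ler_wpM2r (ler_norm _); exact: ltW.
have := ler_wpM2l (normr_ge0 C) (hM x).
by rewrite exprS (_ : _ * (_ * _) = `|C| * w x * cnorm (u x) * w x ^+ k) //; ring.
Qed.

Lemma elliptic_op_rapid L u : kernel_rapid rho L -> S u -> S (elliptic_op d L u).
Proof.
move=> KL Su.
have := @rapid_fun_lin 1 _ _ (diag_rapid Su) (kernel_op_rapid KL Su).
by rewrite scale1r.
Qed.

Lemma elliptic_op_lin L a (u v : V) : kernel_rapid rho L -> S u -> S v ->
  elliptic_op d L (a *: u + v) = a *: (elliptic_op d L u : V) + elliptic_op d L v.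
Proof.
move=> KL Su Sv; have [N _ hN] := kernel_sum KL.
have [Mu hu] := rapid_fun_bounded Su; have [Mv hv] := rapid_fun_bounded Sv.
apply/funext => x.
have su := summable_mul (hN x) hu; have sv := summable_mul (hN x) hv.
have E : kernel_op L (a *: u + v) x = a * kernel_op L u x + kernel_op L v x.
  rewrite -totalZ // -totalD //; last exact: summableZ.
  by apply: eq_total => y; rewrite -[(a *: u + v) y]/(a * u y + v y); ring.
rewrite /elliptic_op E -[(a *: u + v) x]/(a * u x + v x).
rewrite -[RHS]/(a * (d x * u x + kernel_op L u x) + (d x * v x + kernel_op L v x)).
by ring.
Qed.

Lemma elliptic_op_sum L n (a : 'I_n -> R[i]) (f : 'I_n -> V) : kernel_rapid rho L ->
  (forall i, S (f i)) ->
  elliptic_op d L (\sum_i a i *: f i) = \sum_i a i *: (elliptic_op d L (f i) : V).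
Proof.
move=> KL Sf; suff [_ ->] : S (\sum_i a i *: f i) /\
  elliptic_op d L (\sum_i a i *: f i) = \sum_i a i *: (elliptic_op d L (f i) : V) by [].
elim: n a f Sf => [|n IH] a f Sf.
  rewrite !big_ord0; split; first exact: rapid_fun0.
  have := @elliptic_op_lin L (-1) _ _ KL rapid_fun0 rapid_fun0.
  by rewrite scaler0 addr0 scaleN1r addNr.
have [Sr Er] := IH (fun i => a (lift ord0 i)) (fun i => f (lift ord0 i)) (fun i => Sf _).
rewrite !big_ord_recl; split; first exact: rapid_fun_lin.
by rewrite elliptic_op_lin // Er.
Qed.

(** The entries of [L] are bounded by some [N], so the double sum is dominated by the product of
    [N * cnorm (u x)] and [cnorm (v y)], and the order of summation can be exchanged. *)
Lemma kernel_op_adj L u v : kernel_rapid rho L -> S u -> S v ->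
  dot u (kernel_op L v) = dot (kernel_op (fun x y => L y x) u) v.
Proof.
move=> KL Su Sv; have [N N0 hN] := kernel_sum KL.
have [A hA] := rapid_fun_sum Su; have [B hB] := rapid_fun_sum Sv.
have [Mu hu] := rapid_fun_bounded Su; have [Mv hv] := rapid_fun_bounded Sv.
transitivity (total (fun x => total (fun y => u x * (L x y * v y)))).
  apply: eq_total => x; rewrite totalZ //; exact: summable_mul (hN x) hv.
rewrite (@total_swap _ _ _ _ (fun x => N * cnorm (u x)) (fun y => cnorm (v y)) _ _ _ _
  (sum_boundZ (ltW N0) hA) hB).
- apply: eq_total => y; rewrite mulrC -totalZ.
    by apply: eq_total => x; ring.
  apply: (@summable_le _ _ _ (fun x => N * cnorm (u x)) _ _ (sum_boundZ (ltW N0) hA)) => x.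
  by rewrite cnormM ler_wpM2r ?cnorm_ge0 // (sum_bound_pt (hN x)).
- by move=> x; rewrite mulr_ge0 ?cnorm_ge0 ?ltW.
- by move=> y; exact: cnorm_ge0.
- move=> x y; rewrite !cnormM mulrA ler_wpM2r ?cnorm_ge0 // mulrC.
  by rewrite ler_wpM2r ?cnorm_ge0 // (sum_bound_pt (hN x)).
Qed.

Lemma elliptic_op_adj L u v : kernel_rapid rho L -> kernel_rapid rho (fun x y => L y x) ->
  S u -> S v -> dot u (elliptic_op d L v) = dot (elliptic_op d (fun x y => L y x) u) v.
Proof.
move=> KL KLt Su Sv.
have E (M : X -> X -> R[i]) t : elliptic_op d M t =
    (1 : R[i]) *: ((fun x => d x * t x) : V) + kernel_op M t by rewrite scale1r.
rewrite !E dot_linr ?dot_linl -?kernel_op_adj //;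
  try exact: diag_rapid; try exact: kernel_op_rapid.
by congr (_ * _ + _); apply: eq_total => x; ring.
Qed.

(* Outside a large finite set the diagonal part dominates the kernel part, which
   makes the truncated equation solvable by a Neumann series in the sup norm;
   each use of the equation then gains one power of decay. *)
Lemma exterior_solve L : kernel_rapid rho L -> exists A, forall s : seq X,
  (forall x, x \notin s -> A <= w x) -> forall g, S g ->
  exists u, [/\ S u, forall x, x \in s -> u x = 0 &
             forall x, x \notin s -> elliptic_op d L u x = g x].
Proof.
move=> KL; have [N N0 hN] := kernel_sum KL.
(* The summand 2 gives [c * (w x - 1) >= c / 2 * w x]; the summand [4 * N / c] forces
   [cnorm (d x) >= 2 * N], so that the kernel divided by the diagonal has norm at most one half. *)
exists (2 + 4 * N / c) => s sA g Sg.
have dlow x : x \notin s -> c / 2 * w x <= cnorm (d x) /\ 2 * N <= cnorm (d x).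
  move=> /sA wA; have dx := d_ge x.
  have h4 : 4 * N <= c * (w x - 2) by rewrite [leRHS]mulrC -ler_pdivrMr //; lra.
  by have c0 := c_gt0; split; nra.
have d0 x : x \notin s -> 0 < cnorm (d x) by move=> /dlow[_]; lra.
pose q x : R[i] := if x \in s then 0 else (d x)^-1.
have qw x : cnorm (q x) * w x <= 2 / c.
  rewrite /q; case: ifPn => [_|xs]; first by rewrite cnorm0 mul0r divr_ge0 // ltW.
  have [h _] := dlow x xs; have dx := d0 x xs.
  by rewrite cnormV mulrC ler_pdivrMr // mulrAC ler_pdivlMr //; lra.
have qN x : cnorm (q x) * N <= 2^-1.
  rewrite /q; case: ifPn => [_|xs]; first by rewrite cnorm0 mul0r invr_ge0.
  have [_ h] := dlow x xs; have dx := d0 x xs.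
  by rewrite cnormV mulrC ler_pdivrMr //; lra.
have qb x : cnorm (q x) <= 2 / c.
  by apply: le_trans (qw x); rewrite ler_peMr ?cnorm_ge0.
have [Mg hg] := rapid_fun_bounded Sg.
have Mg0 : 0 <= `|Mg| by [].
have c20 : 0 <= 2 / c by rewrite divr_ge0 // ltW.
pose K := 2 / c * `|Mg|; have K0 : 0 <= K by rewrite mulr_ge0.
(* The terms of the Neumann series for [u = q * (g - L u)]; the truncation of [q] to the complement
   of [s] makes every term vanish on [s]. *)
pose v := fix v (j : nat) : X -> R[i] :=
  if j is j'.+1 then fun x => - q x * kernel_op L (v j') x else fun x => q x * g x.
have vle j x : cnorm (v j x) <= K * (2^-1) ^+ j.
  elim: j x => [|j IH] x.
    rewrite expr0 mulr1 /= cnormM ler_pM ?cnorm_ge0 //.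
    exact: le_trans (hg x) (ler_norm _).
  have h : cnorm (kernel_op L (v j) x) <= K * (2^-1) ^+ j * N.
    have := @kernel_op_decay L (v j) 0 (K * (2^-1) ^+ j) N x.
    rewrite expr0 mulr1; apply.
      by apply: (sum_bound_le _ (hN x)) => y; rewrite expr0 mulr1.
    by move=> y; rewrite expr0 mulr1.
  rewrite /= cnormM cnormN exprSr mulrA.
  apply: le_trans (ler_wpM2l (cnorm_ge0 _) h) _.
  rewrite mulrCA; apply: ler_wpM2l (qN x).
  by rewrite mulr_ge0 // exprn_ge0 // invr_ge0.
have geoB := sum_bound_geom K0.
have vsum x : summable (fun j => v j x).
  by apply: (summable_le _ geoB) => j; exact: vle.
pose u x := total (fun j => v j x).
have ub x : cnorm (u x) <= K * 2 by apply: (total_le _ geoB) => j; exact: vle.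
have kvsum x : summable (fun j => kernel_op L (v j) x).
  apply: (@summable_le _ _ _ (fun j => N * (K * (2^-1) ^+ j)) _ _ (sum_boundZ (ltW N0) geoB)).
  move=> j; rewrite mulrC.
  have := @kernel_op_decay L (v j) 0 (K * (2^-1) ^+ j) N x.
  rewrite expr0 mulr1; apply.
    by apply: (sum_bound_le _ (hN x)) => y; rewrite expr0 mulr1.
  by move=> y; rewrite expr0 mulr1.
have Lu x : kernel_op L u x = total (fun j => kernel_op L (v j) x).
  transitivity (total (fun y => total (fun j => L x y * v j y))).
    by apply: eq_total => y; rewrite totalZ.
  apply: (@total_swap _ _ _ _ (fun y => cnorm (L x y)) _ _ _ _ _ (hN x) geoB).
  - by move=> y; exact: cnorm_ge0.
  - by move=> j; rewrite mulr_ge0 // exprn_ge0 // invr_ge0.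
  - by move=> y j; rewrite cnormM ler_wpM2l ?cnorm_ge0.
have uE x : u x = q x * (g x - kernel_op L u x).
  rewrite /u total_S /=; last exact: summableZ.
  by rewrite totalZ // -Lu; ring.
have Su : S u.
  elim=> [|k [M hM]].
    by exists (K * 2) => x; rewrite expr0 mulr1.
  have [Mk hMk] := Sg k; have [Nk hNk] := KL k.
  exists (2 / c * (Mk + M * Nk)) => x.
  rewrite uE cnormM exprS.
  rewrite (_ : _ * _ = (cnorm (q x) * w x) * (cnorm (g x - kernel_op L u x) * w x ^+ k));
    last by ring.
  apply: ler_pM => //.
  - by rewrite mulr_ge0 ?cnorm_ge0 ?ltW.
  - by rewrite mulr_ge0 ?cnorm_ge0 ?ltW.
  apply: le_trans (_ : (cnorm (g x) + cnorm (kernel_op L u x)) * w x ^+ k <= _).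
    by apply: ler_wpM2r; [exact: ltW|exact: cnormB].
  by rewrite mulrDl; apply: lerD (hMk x) _; exact: kernel_op_decay.
exists u; split=> // x xs; first by rewrite uE /q xs mul0r.
rewrite /elliptic_op {1}uE /q (negPf xs) mulrA mulfV ?mul1r; first by ring.
by rewrite -cnorm_gt0 d0.
Qed.

Lemma sum_delta (s : seq X) (f : X -> R[i]) : uniq s -> forall x,
  (\sum_(j < size s) f (tnth (in_tuple s) j) *: (delta_fun R (tnth (in_tuple s) j) : V)) x =
  if x \in s then f x else 0.
Proof.
move=> us x; rewrite fct_sumE.
rewrite -(big_tnth 0 +%R s xpredT (fun y => (f y *: (delta_fun R y : V)) x)).
rewrite (eq_bigr (fun y => f y * (x == y)%:R)) //.
case: ifPn => xs.
  rewrite (bigD1_seq x) //= eqxx mulr1 big1 ?addr0 // => y yx.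
  by rewrite eq_sym (negPf yx) mulr0.
rewrite big1_seq // => y /andP[_ ys].
by case: eqP => [xy|_]; [move: xs; rewrite xy ys|rewrite mulr0].
Qed.

(** * Finite rank perturbation and Fredholm duality for an elliptic kernel operator *)

Section Duality.
Variable L : X -> X -> R[i].
Hypothesis KL : kernel_rapid rho L.
Hypothesis KLt : kernel_rapid rho (fun x y => L y x).

Let D : V -> V := elliptic_op d L.
Let T : V -> V := elliptic_op d (fun x y => L y x).

(** With [a j] the delta functions on [s] and [b j = T (a j) - a j], one has
    [dot (b j) h = D h (p j) - h (p j)]. Subtracting the finite rank term therefore replaces [D h]
    by [h] itself on [s], so the perturbed equation reads [h = g] on [s] and [D h = g] off [s]. On
    the transposed side the perturbed operator is [T] applied to the part of [h] off [s], plus the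
    part of [h] on [s]. *)
Lemma finite_rank_surj : exists N (a b : 'I_N -> V),
  [/\ forall j, S (a j), forall j, S (b j),
      forall g, S g -> exists2 h, S h & D h = g + \sum_j dot (b j) h *: a j &
      forall g, S g -> exists2 h, S h & T h = g + \sum_j dot h (a j) *: b j].
Proof.
have [A1 h1] := exterior_solve KL; have [A2 h2] := exterior_solve KLt.
have [s us sA] := w_fin (`|A1| + `|A2|).
have {}h1 := h1 s ltac:(move=> x /sA; have := ler_norm A1; have := normr_ge0 A2; lra).
have {}h2 := h2 s ltac:(move=> x /sA; have := ler_norm A2; have := normr_ge0 A1; lra).
pose p j := tnth (in_tuple s) j.
pose a j : V := delta_fun R (p j).
pose b j : V := (-1 : R[i]) *: a j + T (a j).
have Sa j : S (a j) by exact: rapid_fun_delta.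
have STa j : S (T (a j)) by apply: elliptic_op_rapid.
have Ssum (f : X -> R[i]) : S (\sum_j f (p j) *: a j).
  apply: big_ind => [|u v Su Sv|j _]; first exact: rapid_fun0.
    by rewrite -[u]scale1r; exact: rapid_fun_lin.
  by rewrite -[_ *: _]addr0; apply: rapid_fun_lin => //; exact: rapid_fun0.
exists (size s), a, b; split=> [//|j|g Sg|g Sg].
- exact: rapid_fun_lin.
- pose h1g : V := \sum_j g (p j) *: a j.
  have Sh1 : S h1g := Ssum g.
  have SD1 : S (D h1g) by exact: (elliptic_op_rapid KL (Ssum g)).
  (* The values on [s] are prescribed by [h1g]; the exterior equation is solved with right side
     [g - D h1g], which corrects for their contribution off [s]. *)
  have [u [Su us0 uE]] := h1 _ (rapid_fun_lin (-1) SD1 Sg).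
  have Sh : S (1 *: u + h1g : V) by exact: (rapid_fun_lin 1 Su (Ssum g)).
  exists (1 *: u + h1g : V) => //; set h : V := 1 *: u + h1g.
  have hs x : x \in s -> h x = g x.
    move=> xs; rewrite -[h x]/(1 * u x + h1g x) us0 // mulr0 add0r.
    by rewrite /h1g sum_delta // xs.
  have bE j : dot (b j) h = D h (p j) - h (p j).
    by rewrite dot_linl // -elliptic_op_adj // !dot_deltal mulN1r addrC.
  under eq_bigr do rewrite bE.
  apply/funext => x.
  rewrite -[RHS]/(g x + (\sum_j (D h (p j) - h (p j)) *: a j) x).
  rewrite (sum_delta (fun x => D h x - h x) us); case: ifPn => xs.
    by rewrite hs //; ring.
  rewrite addr0 /D elliptic_op_lin //.
  rewrite -[LHS]/(1 * elliptic_op d L u x + elliptic_op d L h1g x) uE //.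
  rewrite -[((-1) *: D h1g + g) x]/(-1 * elliptic_op d L h1g x + g x); ring.
(* Here the exterior part is found first, and the values [f = g - T u] on [s] are read off
   afterwards. *)
- have [u [Su us0 uE]] := h2 _ Sg.
  pose f x := g x - T u x.
  have Sf := Ssum f.
  have Sh : S (1 *: u + \sum_j f (p j) *: a j : V) by exact: (rapid_fun_lin 1 Su (Ssum f)).
  exists (1 *: u + \sum_j f (p j) *: a j : V) => //.
  set h : V := 1 *: u + _.
  have hs x : x \in s -> h x = f x.
    move=> xs; rewrite -[h x]/(1 * u x + (\sum_j f (p j) *: a j : V) x) us0 // mulr0 add0r.
    by rewrite sum_delta // xs.
  rewrite (eq_bigr (fun j => - (f (p j) *: a j) + f (p j) *: T (a j))); last first.
    move=> j _; rewrite dot_deltar hs ?mem_tnth //.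
    by rewrite /b scalerDr scaleN1r scalerN.
  rewrite /T elliptic_op_lin // elliptic_op_sum // big_split /= addrA; congr (_ + _).
  apply/funext => x; rewrite sumrN.
  rewrite -[RHS]/(g x - (\sum_j f (p j) *: a j : V) x) sum_delta //.
  rewrite -[LHS]/(1 * elliptic_op d (fun x y => L y x) u x) mul1r.
  case: ifPn => xs; last by rewrite uE // subr0.
  rewrite /f /T; ring.
Qed.

Let S0 : S (0 : V) := rapid_fun0.
Let SD (v : V) : S v -> S (D v) := fun Sv => elliptic_op_rapid KL Sv.
Let ST (v : V) : S v -> S (T v) := fun Sv => elliptic_op_rapid KLt Sv.
Let adj (u v : V) : S u -> S v -> dot u (D v) = dot (T u) v :=
  fun Su Sv => elliptic_op_adj KL KLt Su Sv.
Let ndl (v : V) : S v -> (forall t, S t -> dot v t = 0) -> v = 0.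
Proof. by move=> Sv h; apply: dot_nondeg => // t St; rewrite dotC h. Qed.

Lemma elliptic_solve (g : V) : S g -> (forall u, S u -> T u = 0 -> dot u g = 0) ->
  exists2 v, S v & D v = g.
Proof.
have [N [a [b [Sa Sb Ds Ts]]]] := finite_rank_surj.
exact: (fredholm_solve S0 rapid_fun_lin dot_linl dot_linr dot_nondeg ndl SD ST adj Sa Sb Ds Ts).
Qed.

Lemma elliptic_ker_dual (phi : V -> R[i]) :
  (forall a (u v : V), S u -> S v -> T u = 0 -> T v = 0 ->
    phi (a *: u + v) = a * phi u + phi v) ->
  exists2 v, S v & forall u, S u -> T u = 0 -> phi u = dot u v.
Proof.
have [N [a [b [Sa Sb Ds Ts]]]] := finite_rank_surj.
exact: (fredholm_ker_dual S0 rapid_fun_lin dot_linl dot_linr ndl SD ST adj Sa Sb Ds Ts).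
Qed.

Lemma elliptic_coker_dual (psi : V -> R[i]) :
  (forall a (u v : V), S u -> S v -> psi (a *: u + v) = a * psi u + psi v) ->
  (forall v, S v -> psi (D v) = 0) ->
  exists u, [/\ S u, T u = 0 & forall v, S v -> psi v = dot u v].
Proof.
have [N [a [b [Sa Sb Ds Ts]]]] := finite_rank_surj.
exact: (fredholm_coker_dual S0 rapid_fun_lin dot_linl dot_linr ndl SD ST adj Sa Sb Ds Ts).
Qed.

End Duality.
End Elliptic.

(** * The twisted convolution algebra *)

Local Notation Z2 := (int * int)%type.

Definition wt (R : realType) (x : Z2) : R := (1 + `|x.1| + `|x.2|)%:~R.

Definition uncurryA (R : realType) (a : coeff R) : Z2 -> R[i] := fun x => a x.1 x.2.

Definition curryA (R : realType) (a : Z2 -> R[i]) : coeff R := fun m n => a (m, n).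

Section Weights.
Variable R : realType.
Local Notation wt := (wt R).

Lemma wt_ge1 x : 1 <= wt x.
Proof. by rewrite /wt ler1z; lia. Qed.

Lemma wt_gt0 x : 0 < wt x.
Proof. exact: lt_le_trans (wt_ge1 x). Qed.

Lemma wt_ge0 x : 0 <= wt x.
Proof. exact: ltW (wt_gt0 x). Qed.

Lemma wtN x : wt (- x) = wt x.
Proof. by rewrite /wt /= !normrN. Qed.

Lemma wtD x y : wt (x + y) <= wt x * wt y.
Proof.
rewrite /wt -intrM ler_int /=.
have := ler_normD x.1 y.1; have := ler_normD x.2 y.2.
have := normr_ge0 x.1; have := normr_ge0 y.1; have := normr_ge0 x.2; have := normr_ge0 y.2.
move: (`|x.1|) (`|x.2|) (`|y.1|) (`|y.2|) (`|x.1 + y.1|) (`|x.2 + y.2|).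
by move=> a b e f g h; nia.
Qed.

Lemma wt_peetre x y : wt x <= wt (x - y) * wt y.
Proof. by rewrite -{1}(subrK y x) wtD. Qed.

Lemma sum_bound_nat : sum_bound (fun n : nat => ((1 + n%:R) ^+ 2)^-1 : R) 2.
Proof.
move=> s us.
pose N := (\max_(n <- s) n).+1.
apply: le_trans (_ : \sum_(n <- iota 0 N) ((1 + n%:R) ^+ 2)^-1 <= _).
  apply: le_sum_sub => //; first exact: iota_uniq.
  by move=> n ns; rewrite mem_iota /= add0n ltnS leq_bigmax_seq.
(* A telescoping majorant: its increment 2 / ((1 + N) (2 + N)) is at least 1 / (1 + N)^2. *)
suff : \sum_(n <- iota 0 N) ((1 + n%:R) ^+ 2)^-1 <= 2 - 2 / (1 + N%:R) :> R.
  by move=> h; apply: le_trans h _; rewrite gerBl divr_ge0 // addr_ge0.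
elim: {s us} N => [|N IH]; first by rewrite big_nil addr0 divr1 subrr.
rewrite -[in iota _ _]addn1 iotaD big_cat /= big_seq1 add0n.
apply: le_trans (lerD IH (lexx _)) _.
have N0 : 0 <= N%:R :> R by [].
rewrite -[N.+1%:R]natr1; move: (N%:R) N0 => t t0.
have h1 : 1 + t != 0 by rewrite gt_eqF //; lra.
have h2 : 1 + (t + 1) != 0 by rewrite gt_eqF //; lra.
rewrite -subr_ge0.
rewrite (_ : _ - _ = t / ((1 + t) ^+ 2 * (1 + (t + 1)))); last by field; rewrite h1 h2.
by rewrite divr_ge0 // mulr_ge0 ?exprn_ge0 //; lra.
Qed.

(** An integer is determined by its sign and absolute value; one factor 2 counts the signs, the
    other is the bound over [nat]. *)
Lemma sum_bound_int : sum_bound (fun m : int => ((1 + `|m|%:~R) ^+ 2)^-1 : R) (2 * 2).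
Proof.
pose f (m : int) := (0 <= m, `|m|%N).
have fI : injective f.
  by move=> m n [/eqP h1 h2]; lia.
have hb : sum_bound (fun _ : bool => 1 : R) 2.
  have := @sum_bound_fin R bool (fun=> 1) (fun=> ler01).
  by rewrite sumr_const card_bool.
have := sum_bound_inj fI (sum_bound_prod (fun=> ler01) _ hb sum_bound_nat).
move=> /(_ (fun n => ltac:(by rewrite invr_ge0 exprn_ge0 // addr_ge0))).
apply: sum_bound_le => m; rewrite mul1r /=.
by rewrite -[`|m|]abszE -pmulrn.
Qed.

(** The exponent 4 leaves a square for each coordinate: [wt x ^+ 4] dominates the product of the
    squares of 1 + |m| and 1 + |n|. *)
Lemma wt_sum : sum_bound (fun x => (wt x ^+ 4)^-1) (2 * 2 * (2 * 2)).
Proof.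
have pos (m : int) : 0 < 1 + `|m|%:~R :> R.
  by rewrite ltr_pwDl // ler0z.
have pos2 (m : int) : 0 <= ((1 + `|m|%:~R) ^+ 2)^-1 :> R.
  by rewrite invr_ge0 exprn_ge0 // ltW.
apply: (sum_bound_le _ (sum_bound_prod pos2 pos2 sum_bound_int sum_bound_int)) => x.
rewrite -invfM lef_pV2 ?posrE ?exprn_gt0 ?wt_gt0 ?mulr_gt0 ?exprn_gt0 //.
have le1 (m : int) : 1 + `|m| <= 1 + `|x.1| + `|x.2| -> (1 + `|m|%:~R) ^+ 2 <= wt x ^+ 2.
  move=> h; rewrite ler_sqr ?nnegrE ?wt_ge0 ?(ltW (pos _)) // /wt.
  by rewrite -[1 + _]/(1%:~R + _) -intrD ler_int.
rewrite (exprD _ 2 2); apply: ler_pM; try exact: exprn_ge0 (ltW (pos _)).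
  by apply: le1; lia.
by apply: le1; lia.
Qed.

Definition square (N : nat) : seq Z2 :=
  map (fun z : 'I_(N.*2).+1 * 'I_(N.*2).+1 => ((z.1 : nat)%:Z - N%:Z, (z.2 : nat)%:Z - N%:Z))
    (enum {: 'I_(N.*2).+1 * 'I_(N.*2).+1}).

Lemma square_uniq N : uniq (square N).
Proof.
rewrite map_inj_uniq ?enum_uniq // => -[a b] [a' b'] /= [h1 h2].
by congr (_, _); apply: val_inj => /=; lia.
Qed.

Lemma mem_square N x : (`|x.1| <= N)%N -> (`|x.2| <= N)%N -> x \in square N.
Proof.
case: x => m n /= hm hn.
have h1 : (`|(m + N%:Z)%R|%N < (N.*2).+1)%N by lia.
have h2 : (`|(n + N%:Z)%R|%N < (N.*2).+1)%N by lia.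
apply/mapP; exists (Ordinal h1, Ordinal h2); first by rewrite mem_enum.
by congr (_, _) => /=; lia.
Qed.

Lemma subset_square (s : seq Z2) : exists N, forall M, (N <= M)%N -> {subset s <= square M}.
Proof.
elim: s => [|x s [N hN]]; first by exists 0%N.
exists (maxn N (maxn `|x.1| `|x.2|)) => M hM y; rewrite inE => /predU1P[->|].
  by apply: mem_square; lia.
by apply: hN; lia.
Qed.

Lemma wt_fin A : exists2 s : seq Z2, uniq s & forall x, x \notin s -> A <= wt x.
Proof.
pose N := (Num.truncn `|A|).+1.
exists (square N); first exact: square_uniq.
move=> x; apply: contraR; rewrite -ltNge => h.
have hN : wt x < N%:R.
  by apply: lt_le_trans h _; apply: le_trans (ler_norm A) (ltW (truncnS_gt _)).
have {}hN : (1 + `|x.1| + `|x.2| < N%:Z)%R by rewrite -(ltr_int R).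
have aux (M : nat) (m n : int) : 1 + `|m| + `|n| < M%:Z -> (`|m| <= M)%N /\ (`|n| <= M)%N.
  by lia.
by have [h1 h2] := aux _ _ _ hN; exact: mem_square.
Qed.

(** The squares eventually contain any given finite set, so unordered convergence implies
    convergence along them; real and imaginary parts are treated separately because [climn] is built
    that way. *)
Lemma zsum2E (F : int -> int -> R[i]) : summable (fun x : Z2 => F x.1 x.2) ->
  zsum2 F = total (fun x : Z2 => F x.1 x.2).
Proof.
move=> hF; rewrite /zsum2.
have E : (fun N : nat => \sum_(p < (N.*2).+1) \sum_(q < (N.*2).+1)
    F (p%:Z - N%:Z) (q%:Z - N%:Z)) = fun N => \sum_(x <- square N) F x.1 x.2.
  by apply/funext => N; rewrite big_map big_enum /= pair_big.
rewrite E; set u := fun N => _; set l := total _.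
have ul e : 0 < e -> exists N, forall M, (N <= M)%N -> cnorm (u M - l) <= e.
  move=> e0; have [s _ hs] := totalP hF e0; have [N hN] := subset_square s.
  by exists N => M NM; apply: hs (hN _ NM); exact: square_uniq.
rewrite /climn.
have -> : limn (fun N => complex.Re (u N)) = complex.Re l.
  apply/cvg_lim => //; apply/cvgrPdist_le => e e0; have [N hN] := ul e e0.
  exists N => // M /= NM; apply: le_trans (hN M NM).
  by rewrite distrC -raddfB; exact: cnorm_ge_Re.
have -> : limn (fun N => complex.Im (u N)) = complex.Im l.
  apply/cvg_lim => //; apply/cvgrPdist_le => e e0; have [N hN] := ul e e0.
  exists N => // M /= NM; apply: le_trans (hN M NM).
  by rewrite distrC -raddfB; exact: cnorm_ge_Im.
by case: l {ul}.
Qed.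

Lemma rapidP (a : coeff R) : rapid a <-> rapid_fun wt (uncurryA a).
Proof.
have E k m n M : (`|a m n| * ((1 + `|m| + `|n|)%:~R) ^+ k <= M%:C) =
    (cnorm (a m n) * wt (m, n) ^+ k <= M).
  rewrite normcE -lecR rmorphM rmorphXn; congr (_ * _ ^+ _ <= _).
  by rewrite /wt /= rmorph_int.
split=> h k; have [M hM] := h k; exists M.
  by move=> [m n]; rewrite -E.
by move=> m n; rewrite E; exact: (hM (m, n)).
Qed.

Lemma twistD (theta : R) k l : twist theta (k + l) = twist theta k * twist theta l.
Proof.
rewrite /twist intrD mulrDr cosD sinD; simpc.
by rewrite [X in _ +i* X]addrC.
Qed.

Lemma twist0 (theta : R) : twist theta 0 = 1.
Proof. by rewrite /twist mulr0 cos0 sin0. Qed.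

Lemma cnorm_twist (theta : R) k : cnorm (twist theta k) = 1.
Proof. by rewrite /cnorm /= cos2Dsin2 sqrtr1. Qed.

Lemma twistNK (theta : R) k : twist theta (- k) * twist theta k = 1.
Proof. by rewrite -twistD addNr twist0. Qed.

End Weights.

(* The cocycle of [U^x U^y = cocycle x y U^(x + y)]. *)
Definition cocycle (R : realType) (theta : R) (x y : Z2) : R[i] := twist theta (- (x.2 * y.1)).

Definition tmul (R : realType) (theta : R) (u v : Z2 -> R[i]) : Z2 -> R[i] :=
  fun z => total (fun x => u x * v (z - x) * cocycle theta x (z - x)).

Definition symbol (R : realType) (tau : R[i]) (x : Z2) : R[i] :=
  (2 * pi)%:C * 'i * (x.1%:~R * tau + x.2%:~R).

Section TwistedProduct.
Variables (R : realType) (theta : R) (tau : R[i]).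
Local Notation S := (rapid_fun (wt R)).
Local Notation A := (Z2 -> (R[i])^o).
Local Notation tmul := (tmul theta).

Let S_sum (u : A) : S u -> exists B, sum_bound (fun x => cnorm (u x)) B.
Proof. by move=> Su; exact: (rapid_fun_sum (@wt_ge1 R) (@wt_sum R) Su). Qed.

Let cnorm_cocycle x y : cnorm (cocycle theta x y) = 1.
Proof. exact: cnorm_twist. Qed.

Lemma tmul_summable (u v : A) z : S u -> S v ->
  summable (fun x => u x * v (z - x) * cocycle theta x (z - x)).
Proof.
move=> /S_sum[B uB] /rapid_fun_bounded[M vM].
apply: (@summable_le _ _ _ (fun x => `|M| * cnorm (u x)) _ _ (sum_boundZ (normr_ge0 M) uB)).
move=> x; rewrite !cnormM cnorm_cocycle mulr1 mulrC ler_wpM2r ?cnorm_ge0 //.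
exact: le_trans (vM _) (ler_norm _).
Qed.

Lemma mulAE (a b : coeff R) : rapid a -> rapid b ->
  uncurryA (Defs.mulA theta a b) = tmul (uncurryA a) (uncurryA b).
Proof.
move=> /rapidP Sa /rapidP Sb; apply/funext => z.
rewrite /uncurryA /Defs.mulA zsum2E //.
exact: (tmul_summable z Sa Sb).
Qed.

Lemma tmul_rapid (u v : A) : S u -> S v -> S (tmul u v).
Proof.
(* The [k] powers of the weight are shared by both factors through [wt_peetre]; the 4 extra powers
   on [u] make the sum over [x] converge. *)
move=> Su Sv k; have [Mv hv] := Sv k; have [Mu hu] := Su (k + 4)%N.
exists (`|Mv| * `|Mu| * (2 * 2 * (2 * 2))) => z.
rewrite -ler_pdivlMr ?exprn_gt0 ?wt_gt0 // mulrAC.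
apply: (total_le _ (sum_boundZ _ (@wt_sum R))); last first.
  by rewrite divr_ge0 ?exprn_ge0 ?wt_ge0 ?mulr_ge0.
move=> x; rewrite !cnormM cnorm_cocycle mulr1 mulrAC.
rewrite ler_pdivlMr ?exprn_gt0 ?wt_gt0 //.
rewrite ler_pdivlMr ?exprn_gt0 ?wt_gt0 //.
apply: le_trans (_ : cnorm (u x) * cnorm (v (z - x)) * (wt R (z - x) * wt R x) ^+ k *
    wt R x ^+ 4 <= _).
  apply: ler_wpM2r; first by rewrite exprn_ge0 ?wt_ge0.
  apply: ler_wpM2l; first by rewrite mulr_ge0 ?cnorm_ge0.
  by rewrite lerXn2r ?nnegrE ?mulr_ge0 ?wt_ge0 ?wt_peetre.
rewrite [leLHS](_ : _ = (cnorm (v (z - x)) * wt R (z - x) ^+ k) *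
  (cnorm (u x) * wt R x ^+ (k + 4))); last by rewrite exprMn exprD; ring.
apply: ler_pM; rewrite ?mulr_ge0 ?cnorm_ge0 ?exprn_ge0 ?wt_ge0 //.
  by apply: le_trans (hv _) (ler_norm _).
by apply: le_trans (hu _) (ler_norm _).
Qed.

Lemma tmul_linl c (u v t : A) : S u -> S v -> S t ->
  tmul (c *: u + v) t = c *: (tmul u t : A) + tmul v t.
Proof.
move=> Su Sv St; apply/funext => z.
rewrite -[RHS]/(c * tmul u t z + tmul v t z) /tmul.
have su := tmul_summable z Su St; have sv := tmul_summable z Sv St.
rewrite -totalZ // -totalD //; last exact: summableZ.
by apply: eq_total => x; rewrite -[(c *: u + v) x]/(c * u x + v x); ring.
Qed.

Lemma tmul_linr c (u v t : A) : S u -> S v -> S t ->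
  tmul t (c *: u + v) = c *: (tmul t u : A) + tmul t v.
Proof.
move=> Su Sv St; apply/funext => z.
rewrite -[RHS]/(c * tmul t u z + tmul t v z) /tmul.
have su := tmul_summable z St Su; have sv := tmul_summable z St Sv.
rewrite -totalZ // -totalD //; last exact: summableZ.
by apply: eq_total => x; rewrite -[(c *: u + v) (z - x)]/(c * u (z - x) + v (z - x)); ring.
Qed.

Lemma tmul1l (v : A) : tmul (delta_fun R (0 : Z2)) v = v.
Proof.
apply/funext => z; rewrite /tmul (@total_supp1 _ _ _ 0) /delta_fun.
  by rewrite eqxx mul1r subr0 /cocycle mul0r oppr0 twist0 mulr1.
by move=> y /negPf ->; rewrite !mul0r.
Qed.

Lemma tmul_deltar (u : A) y z :
  tmul u (delta_fun R y) z = u (z - y) * cocycle theta (z - y) y.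
Proof.
rewrite /tmul (@total_supp1 _ _ _ (z - y)) /delta_fun.
  by rewrite subKr eqxx mulr1.
move=> x xzy; rewrite (_ : (z - x == y) = false) ?mulr0 ?mul0r //.
by apply: contraNF xzy => /eqP <-; rewrite subKr.
Qed.

(** After exchanging the two sums and shifting [y] by [x], what remains is the 2-cocycle identity,
    an identity between exponents of [twist]. *)
Lemma tmulA (u v t : A) : S u -> S v -> S t -> tmul (tmul u v) t = tmul u (tmul v t).
Proof.
move=> Su Sv St; apply/funext => z.
have [Bu hu] := S_sum Su; have [Mv hv] := rapid_fun_bounded Sv; have [Bt ht] := S_sum St.
have Mv0 : 0 <= Mv := le_trans (cnorm_ge0 _) (hv 0).
pose F y x := u x * v (y - x) * t (z - y) *
  (cocycle theta x (y - x) * cocycle theta y (z - y)).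
transitivity (total (fun y => total (fun x => F y x))).
  apply: eq_total => y.
  rewrite [LHS](_ : _ = t (z - y) * cocycle theta y (z - y) * tmul u v y); last by ring.
  rewrite -totalZ; last exact: tmul_summable.
  by apply: eq_total => x; rewrite /F; ring.
have htz : sum_bound (fun y => cnorm (t (z - y))) Bt.
  by apply: (sum_bound_inj _ ht); exact: subrI.
rewrite (@total_swap _ _ _ _ (fun y => Mv * cnorm (t (z - y))) (fun x => cnorm (u x)) _ _
  _ _ (sum_boundZ Mv0 htz) hu).
- apply: eq_total => x.
  rewrite [RHS](_ : _ = u x * cocycle theta x (z - x) * tmul v t (z - x)); last by ring.
  rewrite -totalZ; last exact: tmul_summable.
  rewrite -(@total_bij _ _ _ (fun y => y + x) (fun y => y - x) (F ^~ x)).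
  + apply: eq_total => y; rewrite /F addrK (_ : z - (y + x) = z - x - y); last first.
      by rewrite opprD addrA addrAC.
    rewrite (_ : cocycle _ x y * _ =
      cocycle theta x (z - x) * cocycle theta y (z - x - y)); first by ring.
    rewrite /cocycle -!twistD; congr twist => /=; ring.
  + exact: addrK.
  + exact: subrK.
  apply: (@summable_le _ _ _ (fun y => cnorm (u x) * Mv * cnorm (t (z - y))) _ _
    (sum_boundZ _ htz)); last by rewrite mulr_ge0 ?cnorm_ge0.
  move=> y; rewrite /F !cnormM !cnorm_cocycle !mulr1 ler_wpM2r ?cnorm_ge0 //.
  by rewrite ler_wpM2l ?cnorm_ge0.
- by move=> y; rewrite mulr_ge0 ?cnorm_ge0.
- by move=> x; exact: cnorm_ge0.
- move=> y x; rewrite /F !cnormM !cnorm_cocycle !mulr1.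
  rewrite [leLHS](_ : _ = cnorm (v (y - x)) * (cnorm (t (z - y)) * cnorm (u x))); last by ring.
  by rewrite -mulrA ler_wpM2r ?mulr_ge0 ?cnorm_ge0.
Qed.

Lemma symbolD x y : symbol tau (x + y) = symbol tau x + symbol tau y.
Proof. by rewrite /symbol /= !intrD; ring. Qed.

Lemma symbol_le x : cnorm (symbol tau x) <= 2 * pi * (cnorm tau + 1) * wt R x.
Proof.
have cint (m : int) : cnorm (m%:~R : R[i]) = `|m|%:~R.
  by rewrite (_ : m%:~R = (m%:~R : R)%:C) ?cnorm_real ?intr_norm // rmorph_int.
rewrite /symbol !cnormM cnorm_real (_ : cnorm 'i = 1) ?mulr1; last first.
  by rewrite /cnorm /= expr0n add0r expr1n sqrtr1.
have pi0 : 0 <= 2 * pi :> R by rewrite mulr_ge0 // pi_ge0.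
rewrite ger0_norm // -[leRHS]mulrA ler_wpM2l //.
apply: le_trans (cnormD _ _) _; rewrite cnormM !cint /wt !intrD.
have := cnorm_ge0 tau.
have : 0 <= `|x.1|%:~R :> R by rewrite ler0z.
have : 0 <= `|x.2|%:~R :> R by rewrite ler0z.
move: (_%:~R) (_%:~R) (cnorm tau) => a b t a0 b0 t0; nra.
Qed.

(** The imaginary part of z = m tau + n is m Im(tau), so |z| controls |m|; then n = z - m tau
    controls |n|. Adding t |m| <= |z| and t |n| <= (t + |tau|) |z|, with t = |Im(tau)|, gives the
    constant t / (1 + t + |tau|). *)
Lemma symbol_ge : complex.Im tau != 0 ->
  exists2 c : R, 0 < c & forall x, c * (wt R x - 1) <= cnorm (symbol tau x).
Proof.
move=> t0; set t := `|complex.Im tau|.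
have tp : 0 < t by rewrite normr_gt0.
have cint (m : int) : cnorm (m%:~R : R[i]) = `|m|%:~R.
  by rewrite (_ : m%:~R = (m%:~R : R)%:C) ?cnorm_real ?intr_norm // rmorph_int.
have cintE (m : int) : (m%:~R : R[i]) = (m%:~R : R)%:C by rewrite rmorph_int.
have pi0 : 0 < 2 * pi :> R by rewrite mulr_gt0 // pi_gt0.
pose K := 1 + t + cnorm tau; have K0 : 0 < K by have := cnorm_ge0 tau; rewrite /K; lra.
exists (2 * pi * (t / K)); first by rewrite mulr_gt0 // divr_gt0.
move=> x; rewrite /symbol !cnormM cnorm_real (_ : cnorm 'i = 1) ?mulr1; last first.
  by rewrite /cnorm /= expr0n add0r expr1n sqrtr1.
rewrite gtr0_norm // -[leLHS]mulrA; apply: ler_wpM2l; first exact: ltW.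
set z := _ * tau + _.
have h1 : `|x.1|%:~R * t <= cnorm z.
  apply: le_trans (cnorm_ge_Im z).
  rewrite /z /t intr_norm -normrM le_eqVlt; apply/orP; left; apply/eqP; congr `|_|.
  by rewrite !cintE; case: (tau) => a b /=; ring.
have h2 : `|x.2|%:~R <= cnorm z + `|x.1|%:~R * cnorm tau.
  rewrite -!cint -cnormM (_ : x.2%:~R = z - x.1%:~R * tau); last by rewrite /z; ring.
  exact: cnormB.
rewrite mulrAC ler_pdivrMr // /wt !intrD /K.
have := cnorm_ge0 tau; have := cnorm_ge0 z.
move: h1 h2 tp; move: (_%:~R) (_%:~R) (cnorm tau) (cnorm z) (t) => a b s' y r'.
nra.
Qed.

(** Additivity of the symbol, [symbol tau z = symbol tau x + symbol tau (z - x)], applied inside the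
    convolution sum. *)
Lemma tmul_leibniz (u v : A) : S u -> S v ->
  (fun z => symbol tau z * tmul u v z) =
  (tmul (fun x => symbol tau x * u x) v : A) + tmul u (fun x => symbol tau x * v x).
Proof.
move=> Su Sv; apply/funext => z.
have Sd (t : A) : S t -> S (fun x => symbol tau x * t x).
  exact: (diag_rapid (@wt_ge1 R) symbol_le).
rewrite -[RHS]/(tmul (fun x => symbol tau x * u x) v z +
  tmul u (fun x => symbol tau x * v x) z).
rewrite -totalZ -?totalD; try exact: tmul_summable; try by apply: tmul_summable => //; exact: Sd.
  apply: eq_total => x.
  have -> : symbol tau z = symbol tau x + symbol tau (z - x) by rewrite -symbolD addrC subrK.
  by ring.
exact: (tmul_summable z Su (Sd _ Sv)).
Qed.

End TwistedProduct.

(** * Row and column vectors *)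

(** Maps such as the projection onto [E] are known to be additive on rapid vectors only, so the
    usual lemmas on morphisms do not apply. *)
Lemma additive_on_sum (V W : zmodType) (S : V -> Prop) (G : V -> W) (I : Type) (r : seq I)
    (f : I -> V) : S 0 -> (forall u v, S u -> S v -> S (u + v)) ->
  (forall u v, S u -> S v -> G (u + v) = G u + G v) -> (forall i, S (f i)) ->
  S (\sum_(i <- r) f i) /\ G (\sum_(i <- r) f i) = \sum_(i <- r) G (f i).
Proof.
move=> S0 SD GD Sf.
have G0 : G 0 = 0.
  by have /eqP := GD 0 0 S0 S0; rewrite addr0 -subr_eq subrr eq_sym => /eqP.
elim: r => [|i r [Sr Er]]; first by rewrite !big_nil.
by rewrite !big_cons GD // Er; split=> //; exact: SD.
Qed.

Section FreeModule.
Variables (R : realType) (theta : R) (tau : R[i]) (n : nat).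
Local Notation X := ('I_n * Z2)%type.
Local Notation V := (X -> (R[i])^o).
Local Notation A := (Z2 -> (R[i])^o).
Local Notation SA := (rapid_fun (wt R)).
Local Notation tmul := (tmul theta).

Definition vec_wt (x : X) : R := wt R x.2.
Definition vec_dist (x y : X) : R := wt R (x.2 - y.2).
Definition vec_symbol (x : X) : R[i] := symbol tau x.2.
Definition comp (v : V) (k : 'I_n) : A := fun y => v (k, y).
Definition rmul (v : V) (a : A) : V := fun x => tmul (comp v x.1) a x.2.
Definition basis (k : 'I_n) : V := delta_fun R (k, 0 : Z2).
Definition deltaV (v : V) : V := fun x => vec_symbol x * v x.

Local Notation S := (rapid_fun vec_wt).

Lemma vec_wt_ge1 x : 1 <= vec_wt x.
Proof. exact: wt_ge1. Qed.

Lemma vec_dist_ge0 x y : 0 <= vec_dist x y.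
Proof. exact: wt_ge0. Qed.

Lemma vec_peetre x y : vec_wt x <= vec_dist x y * vec_wt y.
Proof. exact: wt_peetre. Qed.

Let ones_bound : sum_bound (fun _ : 'I_n => 1 : R) n%:R.
Proof.
have := @sum_bound_fin R 'I_n (fun=> 1) (fun=> ler01).
by rewrite sumr_const card_ord.
Qed.

Let wtV4_ge0 z : 0 <= (wt R z ^+ 4)^-1.
Proof. by rewrite invr_ge0 exprn_ge0 // wt_ge0. Qed.

Lemma vec_wt_sum : sum_bound (fun x => (vec_wt x ^+ 4)^-1) (n%:R * (2 * 2 * (2 * 2))).
Proof.
apply: (sum_bound_le _ (sum_bound_prod (fun=> ler01) wtV4_ge0 ones_bound (@wt_sum R))) => x.
by rewrite mul1r.
Qed.

Lemma vec_wt_fin B : exists2 s : seq X, uniq s & forall x, x \notin s -> B <= vec_wt x.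
Proof.
have [s us hs] := wt_fin B.
exists [seq (k, y) | k <- enum 'I_n, y <- s].
  by apply: allpairs_uniq; rewrite ?enum_uniq // => -[? ?] [? ?].
move=> [k y] h; apply: hs; apply: contra h => ys.
by apply/allpairsP; exists (k, y); rewrite mem_enum.
Qed.

(** Domination by a rapid function of the difference of frequencies suffices: 4 of the [k + 4]
    powers of decay pay for the sum over frequencies, and the finite index contributes the factor
    [n]. *)
Lemma kernel_rapid_conv (K : X -> X -> R[i]) (h : Z2 -> R) :
  (forall x y, cnorm (K x y) <= h (x.2 - y.2)) ->
  (forall k, exists M : R, forall z, h z * wt R z ^+ k <= M) -> kernel_rapid vec_dist K.
Proof.
move=> Kh hR k; have [M hM] := hR (k + 4)%N.
exists (n%:R * (`|M| * (2 * 2 * (2 * 2)))) => x.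
have inj : injective (fun y : Z2 => x.2 - y) by exact: subrI.
have hb := sum_boundZ (normr_ge0 M) (sum_bound_inj inj (@wt_sum R)).
have g0 z : 0 <= `|M| * (wt R (x.2 - z) ^+ 4)^-1 by rewrite mulr_ge0.
apply: (sum_bound_le _ (sum_bound_prod (fun=> ler01) g0 ones_bound hb)) => y.
rewrite mul1r ler_pdivlMr ?exprn_gt0 ?wt_gt0 // /vec_dist -mulrA -exprD.
apply: le_trans (_ : h (x.2 - y.2) * wt R (x.2 - y.2) ^+ (k + 4) <= _).
  by rewrite ler_wpM2r ?exprn_ge0 ?wt_ge0.
exact: le_trans (hM _) (ler_norm _).
Qed.

Lemma rapid_comp (v : V) : S v <-> forall k, SA (comp v k).
Proof.
split=> [Sv j k|h k].
  by have [M hM] := Sv k; exists M => y; exact: (hM (j, y)).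
have /choice[M hM] : forall j, exists M : R, forall y, cnorm (v (j, y)) * wt R y ^+ k <= M.
  by move=> j; exact: h.
exists (\sum_j `|M j|) => -[j y]; apply: le_trans (hM j y) _.
apply: le_trans (ler_norm _) _.
by rewrite (bigD1 j) //= lerDl sumr_ge0.
Qed.

Lemma rapid_basis k : S (basis k).
Proof. by apply: rapid_fun_delta; exact: vec_wt_ge1. Qed.

Lemma rapid_rmul v a : S v -> SA a -> S (rmul v a).
Proof.
move=> /rapid_comp Sv Sa; apply/rapid_comp => k.
exact: tmul_rapid (Sv k) Sa.
Qed.

Lemma rapid_deltaV v : S v -> S (deltaV v).
Proof.
apply: (diag_rapid vec_wt_ge1) => x; exact: symbol_le.
Qed.

Lemma rapid_add (u v : V) : S u -> S v -> S (u + v).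
Proof. by move=> Su Sv; rewrite -[u]scale1r; exact: (rapid_fun_lin vec_wt_ge1 1 Su Sv). Qed.

Lemma rapid_sub (u v : V) : S u -> S v -> S (u - v).
Proof.
by move=> Su Sv; rewrite addrC -scaleN1r; exact: (rapid_fun_lin vec_wt_ge1 (-1) Sv Su).
Qed.

Lemma rapidA_add (u v : A) : SA u -> SA v -> SA (u + v).
Proof. by move=> Su Sv; rewrite -[u]scale1r; exact: (rapid_fun_lin (@wt_ge1 R) 1 Su Sv). Qed.

Lemma tmulDl (u v t : A) : SA u -> SA v -> SA t -> tmul (u + v) t = (tmul u t : A) + tmul v t.
Proof. by move=> Su Sv St; rewrite -{1}[u]scale1r tmul_linl // scale1r. Qed.

Lemma tmulDr (u v t : A) : SA u -> SA v -> SA t -> tmul t (u + v) = (tmul t u : A) + tmul t v.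
Proof. by move=> Su Sv St; rewrite -{1}[u]scale1r tmul_linr // scale1r. Qed.

Lemma tmul0l (t : A) : tmul (0 : A) t = 0.
Proof.
apply/funext => z; rewrite -[RHS](@total0 R Z2); apply: eq_total => x.
by rewrite -[(0 : A) x]/(0 : R[i]) !mul0r.
Qed.

Lemma rmulDl (u v : V) (a : A) : S u -> S v -> SA a -> rmul (u + v) a = rmul u a + rmul v a.
Proof.
move=> /rapid_comp Su /rapid_comp Sv Sa; apply/funext => x.
by have /(congr1 (fun f => f x.2)) := tmulDl (Su x.1) (Sv x.1) Sa.
Qed.

Lemma rmulBl (u v : V) (a : A) : S u -> S v -> SA a -> rmul (u - v) a = rmul u a - rmul v a.
Proof.
move=> Su Sv Sa; apply/eqP; rewrite eq_sym subr_eq; apply/eqP.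
by rewrite -rmulDl ?subrK //; exact: rapid_sub.
Qed.

Lemma rmul_leibniz (v : V) (a : A) : S v -> SA a ->
  deltaV (rmul v a) = rmul (deltaV v) a + rmul v (fun x => symbol tau x * a x).
Proof.
move=> /rapid_comp Sv Sa; apply/funext => x.
by have /(congr1 (fun f => f x.2)) := @tmul_leibniz _ theta tau _ _ (Sv x.1) Sa.
Qed.

Lemma deltaVD (u v : V) : deltaV (u + v) = deltaV u + deltaV v.
Proof. by apply/funext => x; exact: mulrDr. Qed.

Lemma rmul_basis (k : 'I_n) (a : A) x : rmul (basis k) a x = if x.1 == k then a x.2 else 0.
Proof.
rewrite /rmul; case: eqP => [->|/eqP xk].
  rewrite (_ : comp (basis k) k = delta_fun R (0 : Z2)) ?tmul1l //.
  by apply/funext => y; rewrite /comp /basis /delta_fun xpair_eqE eqxx.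
rewrite (_ : comp (basis k) x.1 = (0 : A)) ?tmul0l //.
by apply/funext => y; rewrite /comp /basis /delta_fun xpair_eqE (negPf xk).
Qed.

Lemma basis_sum (v : V) : v = \sum_k rmul (basis k) (comp v k).
Proof.
apply/funext => -[j y]; rewrite fct_sumE.
under eq_bigr do rewrite rmul_basis /=.
rewrite (bigD1 j) //= eqxx big1 ?addr0 // => k kj.
by rewrite eq_sym (negPf kj).
Qed.

Lemma rmul_const (v : V) c : rmul v (c *: (delta_fun R (0 : Z2) : A)) = c *: v.
Proof.
apply/funext => x; rewrite /rmul /tmul (@total_supp1 _ _ _ x.2).
  rewrite subrr -[(c *: _) 0]/(c * delta_fun R (0 : Z2) 0) /delta_fun eqxx mulr1.
  rewrite /cocycle /= mulr0 oppr0 twist0 mulr1 /comp -surjective_pairing mulrC.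
  by [].
move=> y yx; rewrite -[(c *: _) _]/(c * delta_fun R (0 : Z2) (x.2 - y)) /delta_fun.
by rewrite subr_eq0 eq_sym (negPf yx) !(mulr0, mul0r).
Qed.

(** * Left multiplication by a matrix over the algebra, as a kernel operator *)

Definition conv_kernel (om : 'I_n -> 'I_n -> A) (x y : X) : R[i] :=
  om x.1 y.1 (x.2 - y.2) * cocycle theta (x.2 - y.2) y.2.

Section ConvolutionKernel.
Variable om : 'I_n -> 'I_n -> A.
Hypothesis Som : forall j k, SA (om j k).

Let h z := \sum_j \sum_k cnorm (om j k z).

Let h_ge j k z : cnorm (om j k z) <= h z.
Proof.
rewrite /h (bigD1 j) //= (bigD1 k) //= -addrA lerDl addr_ge0 ?sumr_ge0 // => i _.
- exact: cnorm_ge0.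
- by rewrite sumr_ge0 // => l _; exact: cnorm_ge0.
Qed.

Let h_rapid k : exists M : R, forall z, h z * wt R z ^+ k <= M.
Proof.
have /choice[M hM] : forall jk : 'I_n * 'I_n,
    exists M : R, forall z, cnorm (om jk.1 jk.2 z) * wt R z ^+ k <= M.
  by move=> jk; exact: Som.
exists (\sum_j \sum_l M (j, l)) => z; rewrite mulr_suml.
apply: ler_sum => j _; rewrite mulr_suml; apply: ler_sum => l _.
exact: (hM (j, l)).
Qed.

Lemma conv_kernel_rapid : kernel_rapid vec_dist (conv_kernel om).
Proof.
apply: (kernel_rapid_conv _ h_rapid) => x y.
by rewrite cnormM cnorm_twist mulr1.
Qed.

(** Transposition reflects the difference of frequencies, and the weight is even. *)
Lemma conv_kernel_rapidT : kernel_rapid vec_dist (fun x y => conv_kernel om y x).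
Proof.
apply: (@kernel_rapid_conv _ (fun z => h (- z))) => [x y|k].
  by rewrite cnormM cnorm_twist mulr1 opprB.
by have [M hM] := h_rapid k; exists M => z; rewrite -wtN.
Qed.

Lemma conv_kernel_op (v : V) x : S v ->
  kernel_op (conv_kernel om) v x = \sum_k tmul (om x.1 k) (comp v k) x.2.
Proof.
move=> Sv; have [N _ hN] := kernel_sum conv_kernel_rapid.
have [M hM] := rapid_fun_bounded Sv.
rewrite /kernel_op total_pair; last exact: (summable_mul (hN x) hM).
rewrite total_fin; apply: eq_bigr => k _.
have Sk := (rapid_comp v).1 Sv k.
rewrite /tmul -[RHS](@total_bij _ _ _ (fun y => x.2 - y) (fun y => x.2 - y)).
- by apply: eq_total => y; rewrite subKr /conv_kernel /= /comp; ring.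
- exact: subKr.
- exact: subKr.
- exact: tmul_summable.
Qed.

End ConvolutionKernel.

(* The row vector representing [w] : [trA] of its product with the column [v] is [dot w v]. *)
Definition row_of (w : V) (k : 'I_n) : A := fun y => w (k, - y) * twist theta (- (y.1 * y.2)).

Definition rowdot (w v : V) : A := \sum_k tmul (row_of w k) (comp v k).

Lemma rapid_row_of w k : S w -> SA (row_of w k).
Proof.
move=> /rapid_comp Sw l; have [M hM] := Sw k l; exists M => y.
by rewrite cnormM cnorm_twist mulr1 -wtN; exact: hM.
Qed.

Lemma rapid_rowdot w v : S w -> S v -> SA (rowdot w v).
Proof.
move=> Sw Sv; rewrite /rowdot.
apply: big_ind => [|u t Su St|k _]; first exact: rapid_fun0.
  exact: rapidA_add.
by apply: tmul_rapid; [exact: rapid_row_of|exact: ((rapid_comp v).1 Sv k)].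
Qed.

(** The coefficient of a product at 0 pairs frequency [y] with [- y] and carries the phase
    [cocycle theta y (- y)]; the reflection and the twist in [row_of] undo both. *)
Lemma rowdot_tr w v : S w -> S v -> rowdot w v 0 = dot w v.
Proof.
move=> Sw Sv; rewrite /rowdot fct_sumE /dot total_pair; last first.
  exact: (summable_dot vec_wt_ge1 vec_wt_sum Sw Sv).
rewrite total_fin; apply: eq_bigr => k _.
rewrite -[RHS](@total_bij _ _ _ (@GRing.opp Z2) (@GRing.opp Z2)).
- apply: eq_total => y; rewrite sub0r /row_of /comp /cocycle /=.
  rewrite mulrAC -!mulrA [X in _ * (_ * X)]mulrC [X in _ * X](_ : _ = v (k, - y)) //.
  by rewrite mulrN opprK [y.2 * y.1]mulrC mulrCA twistNK mulr1.
- exact: opprK.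
- exact: opprK.
have hs := summable_dot vec_wt_ge1 vec_wt_sum Sw Sv.
exact: (summable_sect k hs).
Qed.

Lemma rowdot_linl c (u w v : V) : S u -> S w -> S v ->
  rowdot (c *: u + w) v = c *: rowdot u v + rowdot w v.
Proof.
move=> Su Sw Sv; rewrite /rowdot scaler_sumr -big_split /=; apply: eq_bigr => k _.
rewrite (_ : row_of (c *: u + w) k = c *: row_of u k + row_of w k).
  by rewrite tmul_linl //; try exact: rapid_row_of; exact: ((rapid_comp v).1 Sv k).
apply/funext => y.
rewrite -[RHS]/(c * (u (k, - y) * twist theta (- (y.1 * y.2))) +
  w (k, - y) * twist theta (- (y.1 * y.2))).
by rewrite /row_of -[(c *: u + w) _]/(c * u (k, - y) + w (k, - y)); ring.
Qed.

Lemma rowdotDr (w u v : V) : S w -> S u -> S v -> rowdot w (u + v) = rowdot w u + rowdot w v.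
Proof.
move=> Sw Su Sv; rewrite /rowdot -big_split /=; apply: eq_bigr => k _.
by rewrite -tmulDr //; [exact: ((rapid_comp u).1 Su k)|exact: ((rapid_comp v).1 Sv k)|
  exact: rapid_row_of].
Qed.

Lemma rowdot_rmul (w v : V) (a : A) : S w -> S v -> SA a ->
  rowdot w (rmul v a) = tmul (rowdot w v) a.
Proof.
move=> Sw Sv Sa.
have Sk k : SA (tmul (row_of w k) (comp v k)).
  by apply: tmul_rapid; [exact: rapid_row_of|exact: ((rapid_comp v).1 Sv k)].
have [_ ->] := @additive_on_sum A A SA (fun u => tmul u a) _ (index_enum 'I_n)
  (fun k => tmul (row_of w k) (comp v k) : A) (@rapid_fun0 R Z2 (wt R)) rapidA_add
  (fun u t Su St => tmulDl Su St Sa) Sk.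
apply: eq_bigr => k _; rewrite tmulA //; first exact: rapid_row_of.
exact: ((rapid_comp v).1 Sv k).
Qed.

End FreeModule.

(** * The duality pairings of a bundle *)

Section Bundle.
Variables (R : realType) (theta : R) (tau : R[i]) (n : nat).
Local Notation X := ('I_n * Z2)%type.
Local Notation V := (X -> (R[i])^o).
Local Notation A := (Z2 -> (R[i])^o).
Local Notation SA := (rapid_fun (wt R)).
Local Notation S := (rapid_fun (@vec_wt R n)).
Local Notation tmul := (tmul theta).
Local Notation rmul := (rmul theta).
Local Notation deltaV := (@deltaV R tau n).

Lemma dot0l (v : V) : dot (0 : V) v = 0.
Proof. by rewrite -[RHS](@total0 R X); apply: eq_total => x; exact: mul0r. Qed.

Lemma uncurryK (a : coeff R) : curryA (uncurryA a) = a.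
Proof. by []. Qed.

Lemma curryK (a : A) : uncurryA (curryA a) = a.
Proof. by apply/funext => -[]. Qed.

Lemma rapid_curry (a : A) : SA a -> rapid (curryA a).
Proof. by move=> Sa; apply/rapidP; rewrite curryK. Qed.

Lemma rapid_uncurry (a : coeff R) : rapid a -> SA (uncurryA a).
Proof. by move/rapidP. Qed.

Lemma mulA_curry (a b : A) : SA a -> SA b ->
  Defs.mulA theta (curryA a) (curryA b) = curryA (tmul a b).
Proof.
move=> Sa Sb; rewrite -[LHS]uncurryK mulAE ?curryK //; exact: rapid_curry.
Qed.

Lemma constA_curry c : constA c = curryA (c *: (delta_fun R (0 : Z2) : A)).
Proof.
apply/funext => p; apply/funext => q.
rewrite /curryA -[RHS]/(c * delta_fun R (0 : Z2) (p, q)) /delta_fun xpair_eqE.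
by rewrite /constA /scaleA /oneA; case: ifP => // ->.
Qed.

Variables (E : zmodType) (act : E -> coeff R -> E) (nabla : E -> E).
Variables (i : E -> V) (p : V -> E).
Hypothesis i_rapid : forall e, S (i e).
Hypothesis iD : forall e e', i (e + e') = i e + i e'.
Hypothesis i_act : forall e a, SA a -> i (act e (curryA a)) = rmul (i e) a.
Hypothesis pD : forall u v, S u -> S v -> p (u + v) = p u + p v.
Hypothesis p_act : forall v a, S v -> SA a -> p (rmul v a) = act (p v) (curryA a).
Hypothesis iK : forall e, p (i e) = e.
Hypothesis nablaD : forall e e', nabla (e + e') = nabla e + nabla e'.
Hypothesis nabla_leibniz : forall e a, SA a -> nabla (act e (curryA a)) =
  act (nabla e) (curryA a) + act e (curryA (fun x => symbol tau x * a x)).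

Let Sdel (a : A) : SA a -> SA (fun x => symbol tau x * a x).
Proof. exact: (diag_rapid (@wt_ge1 R) (symbol_le tau)). Qed.

Let c1 (v : V) : V := v - i (p v).

(** [c1] is the idempotent onto the complement of [E], and the second summand is the compression of
    the componentwise derivation to it. *)
Definition total_nabla (v : V) : V := i (nabla (p v)) + c1 (deltaV (c1 v)).

Let c1_rapid v : S v -> S (c1 v).
Proof. by move=> Sv; apply: rapid_sub. Qed.

Let c1D u v : S u -> S v -> c1 (u + v) = c1 u + c1 v.
Proof. by move=> Su Sv; rewrite /c1 pD // iD opprD addrACA. Qed.

Let p0 : p 0 = 0.
Proof.
have S0 : S (0 : V) by exact: rapid_fun0.
by have /eqP := pD S0 S0; rewrite addr0 -subr_eq subrr eq_sym => /eqP.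
Qed.

Let i0 : i 0 = 0.
Proof. by have /eqP := iD 0 0; rewrite addr0 -subr_eq subrr eq_sym => /eqP. Qed.

Let p_c1 v : S v -> p (c1 v) = 0.
Proof.
move=> Sv; apply: (addIr (p (i (p v)))).
by rewrite -pD ?subrK ?iK ?add0r //; exact: c1_rapid.
Qed.

Let c1_rmul v a : S v -> SA a -> c1 (rmul v a) = rmul (c1 v) a.
Proof. by move=> Sv Sa; rewrite /c1 p_act // i_act // rmulBl. Qed.

Let c1_idem v : S v -> c1 (c1 v) = c1 v.
Proof. by move=> Sv; rewrite {1}/c1 p_c1 // i0 subr0. Qed.

Lemma total_nabla_rapid v : S v -> S (total_nabla v).
Proof.
by move=> Sv; apply: rapid_add => //; apply/c1_rapid/rapid_deltaV/c1_rapid.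
Qed.

Lemma total_nablaD u v : S u -> S v ->
  total_nabla (u + v) = total_nabla u + total_nabla v.
Proof.
move=> Su Sv; have Scu := rapid_deltaV tau (c1_rapid Su).
have Scv := rapid_deltaV tau (c1_rapid Sv).
rewrite /total_nabla (pD Su Sv) nablaD iD (c1D Su Sv) deltaVD (c1D Scu Scv).
by rewrite addrACA.
Qed.

(** The two summands contribute the Leibniz terms of [i (p v)] and of [c1 v], which add up to that
    of [v]. *)
Lemma total_nabla_leibniz v a : S v -> SA a ->
  total_nabla (rmul v a) = rmul (total_nabla v) a + rmul v (fun x => symbol tau x * a x).
Proof.
move=> Sv Sa; have Sda := Sdel Sa; have Sc := c1_rapid Sv; have Sdc := rapid_deltaV tau Sc.
rewrite /total_nabla p_act // nabla_leibniz // iD !i_act // c1_rmul // rmul_leibniz //.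
rewrite c1D; [|exact: rapid_rmul|exact: rapid_rmul].
rewrite !c1_rmul // c1_idem // rmulDl //; last exact: c1_rapid.
rewrite addrACA; congr (_ + _).
by rewrite -rmulDl // addrC subrK.
Qed.

Lemma total_nabla_i e : total_nabla (i e) = i (nabla e).
Proof.
rewrite /total_nabla iK (_ : c1 (i e) = 0) /c1 ?iK ?subrr //.
rewrite (_ : deltaV 0 = 0); last by apply/funext => x; exact: mulr0.
by rewrite p0 i0 subr0 addr0.
Qed.

Lemma p_total_nabla v : S v -> p (total_nabla v) = nabla (p v).
Proof.
move=> Sv; rewrite /total_nabla pD //; last by apply/c1_rapid/rapid_deltaV/c1_rapid.
by rewrite iK p_c1 ?addr0 //; apply/rapid_deltaV/c1_rapid.
Qed.

(** [E] is just an abelian group with an action, so complex scalars act on it through the constants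
    of the algebra. *)
Lemma p_lin a u v : S u -> S v -> p (a *: u + v) = p v + act (p u) (constA a).
Proof.
move=> Su Sv; have S0 : S (0 : V) by exact: rapid_fun0.
have Sau : S (a *: u : V).
  by rewrite -[a *: u]addr0; exact: (rapid_fun_lin (@vec_wt_ge1 R n) a Su S0).
have Sa : SA (a *: (delta_fun R (0 : Z2) : A)).
  rewrite -[_ *: _]addr0; apply: (rapid_fun_lin (@wt_ge1 R)); last exact: rapid_fun0.
  by apply: rapid_fun_delta; exact: wt_ge1.
by rewrite pD // addrC -(rmul_const theta) p_act // constA_curry.
Qed.

(** The matrix omega: the derivation kills the basis vectors, so D on a basis vector is a column of
    omega. The Leibniz rule then determines D on all rapid vectors. *)
Definition connection_matrix (j k : 'I_n) : A := comp (total_nabla (basis R k)) j.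

Lemma connection_matrix_rapid j k : SA (connection_matrix j k).
Proof.
have Sb : S (total_nabla (basis R k)) by apply/total_nabla_rapid/rapid_basis.
exact: ((rapid_comp _).1 Sb j).
Qed.

Local Notation L := (conv_kernel theta connection_matrix).
Local Notation D := (elliptic_op (@vec_symbol R tau n) L).
Local Notation T := (elliptic_op (@vec_symbol R tau n) (fun x y => L y x)).

Lemma total_nablaE v : S v -> total_nabla v = D v.
Proof.
move=> Sv; have Sk k : SA (comp v k) := (rapid_comp v).1 Sv k.
have Sf k : S (rmul (basis R k) (comp v k)).
  by apply: rapid_rmul (Sk k); exact: rapid_basis.
have S0 : S (0 : V) by exact: rapid_fun0.
rewrite {1}(basis_sum theta v).
have [_ ->] := additive_on_sum (index_enum 'I_n) S0 (@rapid_add R n) total_nablaD Sf.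
rewrite (eq_bigr (fun k => rmul (total_nabla (basis R k)) (comp v k) +
  rmul (basis R k) (comp (deltaV v) k))); last first.
  by move=> k _; rewrite total_nabla_leibniz //; exact: rapid_basis.
rewrite big_split /= -basis_sum addrC; apply/funext => x.
rewrite -[LHS]/(vec_symbol tau x * v x +
  (\sum_k rmul (total_nabla (basis R k)) (comp v k)) x).
rewrite /elliptic_op conv_kernel_op //; last exact: connection_matrix_rapid.
by rewrite fct_sumE.
Qed.

(** * Elements of the dual bundle as row vectors *)

Definition functional (w : V) : E -> coeff R := fun e => curryA (rowdot theta w (i e)).

Lemma functional_dual w : S w -> dual_elt theta act (functional w).
Proof.
move=> Sw; split=> [e|e e'|e a Sa].
- by apply: rapid_curry; exact: rapid_rowdot.
- by rewrite /functional iD rowdotDr.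
- have SA' := rapid_uncurry Sa.
  rewrite -{1}(uncurryK a) /functional i_act // rowdot_rmul //.
  by rewrite -mulA_curry //; exact: rapid_rowdot.
Qed.

Lemma functional_tr w e : S w -> trA (functional w e) = dot w (i e).
Proof. by move=> Sw; rewrite -(rowdot_tr theta) //. Qed.

Lemma functional_lin c u w : S u -> S w ->
  functional (c *: u + w) = dual_add (functional w) (dual_scale c (functional u)).
Proof.
move=> Su Sw; apply/funext => e; rewrite /functional rowdot_linl // addrC.
by [].
Qed.

(** By linearity f(e U^(-z)) = f(e) U^(-z), whose coefficient at 0 is that of f(e) at z times a
    phase. Hence the traces determine [f]. *)
Lemma dual_elt_coeff f e z : dual_elt theta act f ->
  uncurryA (f e) z = trA (f (act e (curryA (delta_fun R (- z) : A)))) *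
    twist theta (- (z.2 * z.1)).
Proof.
move=> [fr _ fa].
have Sd : SA (delta_fun R (- z)) by apply: rapid_fun_delta; exact: wt_ge1.
rewrite fa; last exact: rapid_curry.
rewrite -[f e]uncurryK mulA_curry //; last by apply/rapid_uncurry.
rewrite -[trA _]/(tmul (uncurryA (f e)) (delta_fun R (- z)) 0) tmul_deltar.
rewrite sub0r opprK -mulrA /cocycle /= mulrN opprK -twistD subrr twist0 mulr1.
by [].
Qed.

Lemma dual_elt_eq0 f : dual_elt theta act f -> (forall e, trA (f e) = 0) ->
  forall e, f e = zeroA R.
Proof.
move=> Df f0 e; rewrite -[LHS]uncurryK; apply/funext => a; apply/funext => b.
by rewrite /curryA dual_elt_coeff // f0 mul0r.
Qed.

Lemma dual_elt_eq f g : dual_elt theta act f -> dual_elt theta act g ->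
  (forall e, trA (f e) = trA (g e)) -> f = g.
Proof.
move=> Df Dg fg; apply/funext => e; rewrite -[LHS]uncurryK -[RHS]uncurryK.
apply/funext => a; apply/funext => b.
by rewrite /curryA !dual_elt_coeff // fg.
Qed.

Lemma dual_nabla_dual f : dual_elt theta act f -> dual_elt theta act (dual_nabla tau nabla f).
Proof.
move=> [fr fD fa].
have fS e := rapid_uncurry (fr e).
have sub_rapid e : rapid (dual_nabla tau nabla f e).
  apply/rapidP; have Sd := Sdel (fS e).
  have := rapid_fun_lin (@wt_ge1 R) (-1) (fS (nabla e)) Sd.
  rewrite scaleN1r addrC; exact.
split=> [//|e e'|e a ra].
  rewrite /dual_nabla fD nablaD fD; apply/funext => a; apply/funext => b.
  by rewrite /subA /Defs.addA /deltaA; ring.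
have Sa := rapid_uncurry ra; have Sda := Sdel Sa; have Sdf := Sdel (fS e).
have ea : act e a = act e (curryA (uncurryA a)) by [].
rewrite -[RHS]uncurryK mulAE // -[LHS]uncurryK; congr curryA.
apply/funext => z.
have h1 : uncurryA (f (act e a)) = tmul (uncurryA (f e)) (uncurryA a).
  by rewrite fa // mulAE.
have h2 : uncurryA (f (nabla (act e a))) = (tmul (uncurryA (f (nabla e))) (uncurryA a) : A) +
    tmul (uncurryA (f e)) (fun x => symbol tau x * uncurryA a x).
  rewrite ea nabla_leibniz // fD !fa; try exact: rapid_curry; try exact: ra.
  rewrite -[LHS]/((uncurryA (Defs.mulA theta (f (nabla e)) (curryA (uncurryA a))) : A) +
    uncurryA (Defs.mulA theta (f e) (curryA (fun x => symbol tau x * uncurryA a x)))).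
  by rewrite !mulAE ?curryK //; exact: rapid_curry.
rewrite -[LHS]/(symbol tau z * uncurryA (f (act e a)) z - uncurryA (f (nabla (act e a))) z).
rewrite h1 h2.
have /(congr1 (fun g => g z)) := @tmul_leibniz _ theta tau _ _ (fS e) Sa.
rewrite -[X in X = _]/(symbol tau z * tmul (uncurryA (f e)) (uncurryA a) z) => ->.
have -> : uncurryA (dual_nabla tau nabla f e) = (-1 : R[i]) *: (uncurryA (f (nabla e)) : A) +
    (fun x => symbol tau x * uncurryA (f e) x).
  by rewrite scaleN1r addrC.
rewrite tmul_linl //.
(* [t2] is f(e) delta(a); it comes once from the Leibniz rule of delta and once from that of
   [nabla], with opposite signs. *)
set t1 := tmul _ _; set t2 := tmul _ _; set t3 := tmul _ _.
rewrite -[LHS]/(t1 z + t2 z - (t3 z + t2 z)) -[RHS]/(-1 * t3 z + t1 z).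
by ring.
Qed.

Lemma dual_nabla_tr f e : trA (dual_nabla tau nabla f e) = - trA (f (nabla e)).
Proof. by rewrite /trA /dual_nabla /subA /deltaA !mulr0z mul0r addr0 mulr0 mul0r sub0r. Qed.

(** The row of values of [f] composed with [p] on the basis, stored so that [row_of] gives these
    values back: reflected, with the opposite phase. *)
Definition row_vec (f : E -> coeff R) : V := fun x =>
  uncurryA (f (p (basis R x.1))) (- x.2) * twist theta (x.2.1 * x.2.2).

Lemma row_vec_rapid f : dual_elt theta act f -> S (row_vec f).
Proof.
move=> [fr _ _]; apply/rapid_comp => k l.
have [M hM] := rapid_uncurry (fr (p (basis R k))) l; exists M => y.
by rewrite cnormM cnorm_twist mulr1 -wtN; exact: hM.
Qed.

Lemma row_vec_dot f v : dual_elt theta act f -> S v -> dot (row_vec f) v = trA (f (p v)).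
Proof.
move=> Df Sv; have [fr fD fa] := Df.
rewrite -(rowdot_tr theta) //; last exact: row_vec_rapid.
rewrite /rowdot.
have Sk k : SA (comp v k) := (rapid_comp v).1 Sv k.
have Sf k : S (rmul (basis R k) (comp v k)).
  by apply: rapid_rmul (Sk k); exact: rapid_basis.
have S0 : S (0 : V) by exact: rapid_fun0.
pose G (u : V) : A := uncurryA (f (p u)).
have GD u t : S u -> S t -> G (u + t) = G u + G t.
  by move=> Su St; rewrite /G pD // fD.
have [_ E1] := additive_on_sum (index_enum 'I_n) S0 (@rapid_add R n) GD Sf.
rewrite -[RHS]/(G v 0) {2}(basis_sum theta v) E1; apply: (congr1 (fun g : A => g 0)).
apply: eq_bigr => k _; rewrite /G p_act //; last exact: rapid_basis.
rewrite fa; last exact: rapid_curry.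
rewrite mulAE ?curryK //; last exact: rapid_curry.
rewrite (_ : row_of _ _ _ = uncurryA (f (p (basis R k)))) //.
apply/funext => y; rewrite /row_of /row_vec /= opprK mulrNN -mulrA [X in _ * X]mulrC.
by rewrite twistNK mulr1.
Qed.

(** Extending along [p] and restricting along [i] changes nothing, since [p (i e) = e]; comparing
    traces is enough by [dual_elt_eq]. *)
Lemma functional_row_vec f : dual_elt theta act f -> functional (row_vec f) = f.
Proof.
move=> Df; apply: dual_elt_eq => // [|e]; first exact/functional_dual/row_vec_rapid.
rewrite functional_tr ?row_vec_dot ?iK //; exact: row_vec_rapid.
Qed.

(** * Perfectness of the two pairings *)

Hypothesis Im_tau : complex.Im tau != 0.

Let KL : kernel_rapid (@vec_dist R n) L := conv_kernel_rapid theta connection_matrix_rapid.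
Let KLt : kernel_rapid (@vec_dist R n) (fun x y => L y x) :=
  conv_kernel_rapidT theta connection_matrix_rapid.

Let symbol_low : exists2 c : R, 0 < c &
  forall x, c * (@vec_wt R n x - 1) <= cnorm (vec_symbol tau x).
Proof. by have [c c0 h] := symbol_ge Im_tau; exists c => // x; exact: h. Qed.

Let symbol_upp (x : X) : cnorm (vec_symbol tau x) <= 2 * pi * (cnorm tau + 1) * vec_wt R x.
Proof. exact: symbol_le. Qed.

Let adj (u v : V) : S u -> S v -> dot u (D v) = dot (T u) v.
Proof.
exact: (elliptic_op_adj (@vec_wt_ge1 R n) (@vec_dist_ge0 R n) (@vec_peetre R n)
  (@vec_wt_sum R n) symbol_upp KL KLt).
Qed.

Let ST (v : V) : S v -> S (T v).
Proof.
exact: (elliptic_op_rapid (@vec_wt_ge1 R n) (@vec_dist_ge0 R n) (@vec_peetre R n)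
  symbol_upp KLt).
Qed.

Let functional_nabla w e : S w ->
  trA (dual_nabla tau nabla (functional w) e) = - dot (T w) (i e).
Proof.
move=> Sw; rewrite dual_nabla_tr functional_tr // -total_nabla_i total_nablaE //.
by rewrite adj.
Qed.

Let functional_H0 w : S w -> T w = 0 -> H0v_mem theta tau act nabla (functional w).
Proof.
move=> Sw Tw; have Df := functional_dual Sw; split=> //.
apply: dual_elt_eq0; first exact: dual_nabla_dual.
move=> e; rewrite functional_nabla // Tw.
by rewrite dot0l oppr0.
Qed.

(** Tested against [v], the left side is tr(f(p(D v))) = tr(f(nabla(p v))), which is minus the trace
    of the dual connection of [f] at [p v]. *)
Let row_vec_ker f : H0v_mem theta tau act nabla f -> T (row_vec f) = 0.
Proof.
move=> [Df f0]; have Sr := row_vec_rapid Df.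
apply: (@dot_nondeg _ _ _ (@vec_wt_ge1 R n)); first exact: ST.
move=> v Sv; rewrite dotC -adj // -total_nablaE // row_vec_dot //; last first.
  exact: total_nabla_rapid.
rewrite p_total_nabla //; apply: oppr_inj; rewrite -dual_nabla_tr f0 oppr0.
by [].
Qed.

Let functional_im w : S w -> im_dual_nabla theta tau act nabla (functional (T w)).
Proof.
(* [T] corresponds to minus the dual connection, so the primitive comes from [- w]; the summand 0
   gives it the shape that the linearity lemmas expect. *)
move=> Sw; have SNw : S ((-1 : R[i]) *: w + 0 : V).
  by apply: (rapid_fun_lin (@vec_wt_ge1 R n)) => //; exact: rapid_fun0.
have Df := functional_dual SNw.
exists (functional ((-1 : R[i]) *: w + 0)); split=> // e.
rewrite (_ : functional (T w) = dual_nabla tau nabla (functional ((-1 : R[i]) *: w + 0))) //.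
apply: dual_elt_eq => [||e']; first exact/functional_dual/ST.
  exact: dual_nabla_dual.
rewrite dual_nabla_tr !functional_tr //; last exact: ST.
rewrite -adj // -total_nablaE // total_nabla_i.
rewrite (dot_linl (@vec_wt_ge1 R n) (@vec_wt_sum R n)) //; last exact: rapid_fun0.
by rewrite dot0l addr0 mulN1r opprK.
Qed.

Lemma H1_pairing_wd e e' f : H0v_mem theta tau act nabla f -> im_nabla nabla (e - e') ->
  trA (f e) = trA (f e').
Proof.
move=> [[fr fD fa] f0] [e0 ee'].
have /eqP := dual_nabla_tr f e0; rewrite f0 eq_sym oppr_eq0 => /eqP h.
rewrite -[e](subrK e') ee' fD.
by rewrite -[LHS]/(trA (f (nabla e0)) + trA (f e')) h add0r.
Qed.

(** Elements of [ker T] restrict to horizontal functionals, so [i e] is orthogonal to [ker T] and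
    equals [D v]; applying [p] gives a primitive of [e]. *)
Lemma H1_pairing_inj e : (forall f, H0v_mem theta tau act nabla f -> trA (f e) = 0) ->
  im_nabla nabla e.
Proof.
move=> h; have [c c0 hc] := symbol_low.
have [v Sv Dv] : exists2 v, S v & D v = i e.
  apply: (elliptic_solve (@vec_wt_ge1 R n) (@vec_dist_ge0 R n) (@vec_peetre R n)
    (@vec_wt_sum R n) (@vec_wt_fin R n) c0 symbol_upp hc KL KLt) => // u Su Tu.
  by rewrite -functional_tr //; apply/h/functional_H0.
by exists (p v); rewrite -p_total_nabla // total_nablaE // Dv iK.
Qed.

(** [phi] is pulled back to [ker T] along [functional] and represented there by some [v]; every
    horizontal [f] is reached through its row vector, so [p v] represents [phi]. *)
Lemma H0v_dual_surj (phi : (E -> coeff R) -> R[i]) :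
  (forall f g c, H0v_mem theta tau act nabla f -> H0v_mem theta tau act nabla g ->
     phi (dual_add f (dual_scale c g)) = phi f + c * phi g) ->
  exists e, forall f, H0v_mem theta tau act nabla f -> phi f = trA (f e).
Proof.
move=> phiL; have [c c0 hc] := symbol_low.
have phi_lin a (u w : V) : S u -> S w -> T u = 0 -> T w = 0 ->
    phi (functional (a *: u + w)) = a * phi (functional u) + phi (functional w).
  move=> Su Sw Tu Tw; rewrite functional_lin //.
  by rewrite (phiL _ _ _ (functional_H0 Sw Tw) (functional_H0 Su Tu)) addrC.
have [v Sv hv] := elliptic_ker_dual (@vec_wt_ge1 R n) (@vec_dist_ge0 R n) (@vec_peetre R n)
  (@vec_wt_sum R n) (@vec_wt_fin R n) c0 symbol_upp hc KL KLt
  (phi := fun w => phi (functional w)) phi_lin.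
exists (p v) => f Hf; have Df := Hf.1.
rewrite -{1}(functional_row_vec Df) hv; [|exact: row_vec_rapid|exact: row_vec_ker].
by rewrite row_vec_dot.
Qed.

(** The composite of [psi] with [p] kills the image of [D] because [p D = nabla p], so it is [dot w]
    for some [w] in [ker T]. *)
Lemma H1_dual_surj (psi : E -> R[i]) : Clinear_on_E act psi ->
  (forall e, im_nabla nabla e -> psi e = 0) ->
  exists f, H0v_mem theta tau act nabla f /\ forall e, psi e = trA (f e).
Proof.
move=> psiL psi0; have [c c0 hc] := symbol_low.
have psi_lin a (u v : V) : S u -> S v -> psi (p (a *: u + v)) = a * psi (p u) + psi (p v).
  by move=> Su Sv; rewrite p_lin // psiL addrC.
have [w [Sw Tw hw]] := elliptic_coker_dual (@vec_wt_ge1 R n) (@vec_dist_ge0 R n)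
  (@vec_peetre R n) (@vec_wt_sum R n) (@vec_wt_fin R n) c0 symbol_upp hc KL KLt
  (psi := fun v => psi (p v))
  ltac:(by exact: psi_lin)
  ltac:(by move=> v Sv /=; apply: psi0; exists (p v); rewrite -p_total_nabla // total_nablaE).
exists (functional w); split; first exact: functional_H0.
by move=> e; rewrite functional_tr // -hw // iK.
Qed.

Lemma H0v_pairing_inj f : H0v_mem theta tau act nabla f -> (forall e, trA (f e) = 0) ->
  forall e, f e = zeroA R.
Proof. by move=> [Df _]; exact: dual_elt_eq0. Qed.

Lemma H1v_pairing_wd e f g : H0_mem nabla e -> dual_elt theta act f -> dual_elt theta act g ->
  im_dual_nabla theta tau act nabla (fun x => subA (f x) (g x)) -> trA (f e) = trA (g e).
Proof.
move=> e0 _ _ [h [[hr hD ha] /(_ e) /(congr1 (@trA R))]].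
rewrite dual_nabla_tr e0.
have -> : h 0 = zeroA R.
  have := hD 0 0; rewrite addr0 => /(congr1 (fun a => subA a (h 0))) E0.
  apply/funext => a; apply/funext => b.
  have := congr1 (fun t => t a b) E0; rewrite /subA /Defs.addA subrr addrK.
  by move=> <-.
rewrite -[trA (zeroA R)]/(0 : R[i]) oppr0 -[X in X = _]/(trA (f e) - trA (g e)).
by move/eqP; rewrite subr_eq0 => /eqP.
Qed.

Lemma H0_pairing_inj e : H0_mem nabla e ->
  (forall f, dual_elt theta act f -> trA (f e) = 0) -> e = 0.
Proof.
move=> _ h; rewrite -[e]iK (_ : i e = 0) //.
apply: (@dot_nondeg _ _ _ (@vec_wt_ge1 R n)) => // w Sw.
by rewrite -functional_tr // h //; exact: functional_dual.
Qed.

Let D_i e : D (i e) = i (nabla e).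
Proof. by rewrite -total_nablaE // total_nabla_i. Qed.

Let p_D v : S v -> p (D v) = nabla (p v).
Proof. by move=> Sv; rewrite -total_nablaE // p_total_nabla. Qed.

Lemma H1v_dual_surj (phi : (E -> coeff R) -> R[i]) :
  (forall f g c, dual_elt theta act f -> dual_elt theta act g ->
     phi (dual_add f (dual_scale c g)) = phi f + c * phi g) ->
  (forall f, dual_elt theta act f -> im_dual_nabla theta tau act nabla f -> phi f = 0) ->
  exists e, H0_mem nabla e /\ forall f, dual_elt theta act f -> phi f = trA (f e).
Proof.
move=> phiL phi0; have [c c0 hc] := symbol_low.
have phi_lin a (u w : V) : S u -> S w ->
    phi (functional (a *: u + w)) = a * phi (functional u) + phi (functional w).
  move=> Su Sw; rewrite functional_lin //.
  by rewrite (phiL _ _ _ (functional_dual Sw) (functional_dual Su)) addrC.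
have phi_im v : S v -> phi (functional (T v)) = 0.
  by move=> Sv; apply: phi0; [exact/functional_dual/ST|exact: functional_im].
(* The kernel and its transpose are exchanged with respect to the other pairing: [T] is now the
   operator and [D] its transpose, so the representing vector lies in [ker D]. *)
have [v [Sv Dv hv]] := elliptic_coker_dual (@vec_wt_ge1 R n) (@vec_dist_ge0 R n)
  (@vec_peetre R n) (@vec_wt_sum R n) (@vec_wt_fin R n) c0 symbol_upp hc KLt KL
  phi_lin phi_im.
exists (p v); split; first by rewrite /H0_mem -p_D // Dv p0.
move=> f Df; have Sr := row_vec_rapid Df.
by rewrite -{1}(functional_row_vec Df) (hv _ Sr) dotC row_vec_dot.
Qed.

(** For [u] in [ker D] the vector [p u] is horizontal, so the row vector of [f] is orthogonal to
    [ker D] and lies in the image of [T]; restricting to [E] shows that [f] is a boundary. *)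
Lemma H1v_pairing_inj f : dual_elt theta act f ->
  (forall e, H0_mem nabla e -> trA (f e) = 0) -> im_dual_nabla theta tau act nabla f.
Proof.
move=> Df h; have [c c0 hc] := symbol_low.
have Sr := row_vec_rapid Df.
have [w Sw Tw] : exists2 w, S w & T w = row_vec f.
  apply: (elliptic_solve (@vec_wt_ge1 R n) (@vec_dist_ge0 R n) (@vec_peetre R n)
    (@vec_wt_sum R n) (@vec_wt_fin R n) c0 symbol_upp hc KLt KL) => // u Su Du.
  by rewrite dotC row_vec_dot // h // /H0_mem -p_D // [X in p X]Du p0.
by rewrite -(functional_row_vec Df) -Tw; exact: functional_im.
Qed.

Lemma H0_dual_surj (psi : E -> R[i]) :
  (forall e e' c, H0_mem nabla e -> H0_mem nabla e' ->
     psi (e + act e' (constA c)) = psi e + c * psi e') ->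
  exists f, dual_elt theta act f /\ forall e, H0_mem nabla e -> psi e = trA (f e).
Proof.
move=> psiL; have [c c0 hc] := symbol_low.
have p_ker v : S v -> D v = 0 -> H0_mem nabla (p v).
  by move=> Sv Dv; rewrite /H0_mem -p_D // Dv p0.
have psi_lin a (u v : V) : S u -> S v -> D u = 0 -> D v = 0 ->
    psi (p (a *: u + v)) = a * psi (p u) + psi (p v).
  by move=> Su Sv Du Dv; rewrite p_lin // psiL 1?addrC //; exact: p_ker.
have [w Sw hw] := elliptic_ker_dual (@vec_wt_ge1 R n) (@vec_dist_ge0 R n)
  (@vec_peetre R n) (@vec_wt_sum R n) (@vec_wt_fin R n) c0 symbol_upp hc KLt KL
  (phi := fun v => psi (p v)) psi_lin.
exists (functional w); split; first exact: functional_dual.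
move=> e He; rewrite functional_tr // dotC -hw ?iK //.
by rewrite -[RHS]i0 -[X in _ = i X]He; exact: D_i.
Qed.

End Bundle.

Theorem theorem2p10 (R : realType) (theta : R) (tau : R[i])
    (Htheta : forall q : rat, theta != ratr q) (Htau : complex.Im tau != 0)
    (E : zmodType) (act : E -> coeff R -> E) (nabla : E -> E)
    (HE : holomorphic_bundle theta tau act nabla) :
  (* ---- i = 0 : H^1(E) (x) H^0(E^v) -> C ---- *)
  (* well defined *)
  (forall e e' f, H0v_mem theta tau act nabla f -> im_nabla nabla (e - e') ->
     trA (f e) = trA (f e')) /\
  (* H^1(E) -> H^0(E^v)^* injective *)
  (forall e, (forall f, H0v_mem theta tau act nabla f -> trA (f e) = 0) -> im_nabla nabla e) /\
  (* H^1(E) -> H^0(E^v)^* surjective *)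
  (forall phi : (E -> coeff R) -> R[i],
     (forall f g c, H0v_mem theta tau act nabla f -> H0v_mem theta tau act nabla g ->
        phi (dual_add f (dual_scale c g)) = phi f + c * phi g) ->
     exists e, forall f, H0v_mem theta tau act nabla f -> phi f = trA (f e)) /\
  (* H^0(E^v) -> H^1(E)^* injective *)
  (forall f, H0v_mem theta tau act nabla f -> (forall e, trA (f e) = 0) ->
     forall e, f e = zeroA R) /\
  (* H^0(E^v) -> H^1(E)^* surjective *)
  (forall psi : E -> R[i], Clinear_on_E act psi ->
     (forall e, im_nabla nabla e -> psi e = 0) ->
     exists f, H0v_mem theta tau act nabla f /\ forall e, psi e = trA (f e)) /\
  (* ---- i = 1 : H^0(E) (x) H^1(E^v) -> C ---- *)
  (* well defined *)
  (forall e f g, H0_mem nabla e -> dual_elt theta act f -> dual_elt theta act g ->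
     im_dual_nabla theta tau act nabla (fun x => subA (f x) (g x)) ->
     trA (f e) = trA (g e)) /\
  (* H^0(E) -> H^1(E^v)^* injective *)
  (forall e, H0_mem nabla e -> (forall f, dual_elt theta act f -> trA (f e) = 0) -> e = 0) /\
  (* H^0(E) -> H^1(E^v)^* surjective *)
  (forall phi : (E -> coeff R) -> R[i],
     (forall f g c, dual_elt theta act f -> dual_elt theta act g ->
        phi (dual_add f (dual_scale c g)) = phi f + c * phi g) ->
     (forall f, dual_elt theta act f -> im_dual_nabla theta tau act nabla f -> phi f = 0) ->
     exists e, H0_mem nabla e /\ forall f, dual_elt theta act f -> phi f = trA (f e)) /\
  (* H^1(E^v) -> H^0(E)^* injective *)
  (forall f, dual_elt theta act f -> (forall e, H0_mem nabla e -> trA (f e) = 0) ->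
     im_dual_nabla theta tau act nabla f) /\
  (* H^1(E^v) -> H^0(E)^* surjective *)
  (forall psi : E -> R[i],
     (forall e e' c, H0_mem nabla e -> H0_mem nabla e' ->
        psi (e + act e' (constA c)) = psi e + c * psi e') ->
     exists f, dual_elt theta act f /\ forall e, H0_mem nabla e -> psi e = trA (f e)).
Proof.
have [_ [n [i [p [i_rapid iD i_act [pD p_act iK]]]]] [nablaD _ nabla_leibniz]] := HE.
pose X := ('I_n * Z2)%type.
(* The embedding and projection are repackaged on functions of one variable in [X], the form used by
   the kernel operators. *)
pose ix e : X -> (R[i])^o := fun x => i e x.1 x.2.1 x.2.2.
pose px (v : X -> (R[i])^o) : E := p (fun k a b => v (k, (a, b))).
have vec_rapid v : rapid_fun (@vec_wt R n) v -> rapid_vec (fun k a b => v (k, (a, b))).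
  move=> Sv k; apply/rapidP => l; have [M hM] := Sv l.
  by exists M => -[a b]; exact: (hM (k, (a, b))).
have ix_rapid e : rapid_fun (@vec_wt R n) (ix e).
  by apply/rapid_comp => k; exact: (rapid_uncurry (i_rapid e k)).
have ixD e e' : ix (e + e') = ix e + ix e' by rewrite /ix iD.
have ix_act e a : rapid_fun (wt R) a -> ix (act e (curryA a)) = rmul theta (ix e) a.
  move=> Sa; apply/funext => x; rewrite /ix i_act; last exact: rapid_curry.
  rewrite -[LHS]/(uncurryA (Defs.mulA theta (i e x.1) (curryA a)) x.2).
  by rewrite (mulAE theta (i_rapid e x.1) (rapid_curry Sa)) curryK.
have pxD u v : rapid_fun (@vec_wt R n) u -> rapid_fun (@vec_wt R n) v -> px (u + v) = px u + px v.
  by move=> Su Sv; rewrite -pD //; exact: vec_rapid.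
have px_act v a : rapid_fun (@vec_wt R n) v -> rapid_fun (wt R) a ->
    px (rmul theta v a) = act (px v) (curryA a).
  move=> Sv Sa; rewrite -p_act; [|exact: vec_rapid|exact: rapid_curry].
  congr p; apply/funext => k.
  rewrite -[RHS]/(Defs.mulA theta (curryA (comp v k)) (curryA a)) mulA_curry //.
  exact: ((rapid_comp v).1 Sv k).
have ixK e : px (ix e) = e by rewrite -[RHS]iK.
have nablaL e a : rapid_fun (wt R) a -> nabla (act e (curryA a)) =
    act (nabla e) (curryA a) + act e (curryA (fun x => symbol tau x * a x)).
  by move=> Sa; rewrite nabla_leibniz //; exact: rapid_curry.
split; first exact: (H1_pairing_wd).
split; first exact: (H1_pairing_inj ix_rapid ixD ix_act pxD px_act ixK nablaD nablaL Htau).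
split; first exact: (H0v_dual_surj ix_rapid ixD ix_act pxD px_act ixK nablaD nablaL Htau).
split; first exact: H0v_pairing_inj.
split; first exact: (H1_dual_surj ix_rapid ixD ix_act pxD px_act ixK nablaD nablaL Htau).
split; first exact: H1v_pairing_wd.
split; first exact: (H0_pairing_inj ix_rapid ixD ix_act pxD ixK).
split; first exact: (H1v_dual_surj ix_rapid ixD ix_act pxD px_act ixK nablaD nablaL Htau).
split; first exact: (H1v_pairing_inj ix_rapid ixD ix_act pxD px_act ixK nablaD nablaL Htau).
exact: (H0_dual_surj ix_rapid ixD ix_act pxD px_act ixK nablaD nablaL Htau).
Qed.
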